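(* Let $G$ be a locally compact group. Then: (i) $N_{\mathrm{Tr}}(G)\subseteq N_{\mathrm{SIN}}(G)$. (ii) If $N_{\mathrm{SIN}}(G)$ is not open in $G$, then $\mathrm{T}(G)$ is infinite dimensional. (ii$'$) If $N_{\mathrm{MAP}}(G)$ is of infinite index in $G$, then $\mathrm{T}(G)$ is infinite dimensional.
   Context: For a locally compact group $G$, $\mathrm{T}(G)$ (the traces on $G$) is the set of continuous positive definite functions $u:G\to\mathbb{C}$ with $u(e)=1$ and $u(st)=u(ts)$ for all $s,t\in G$. We say $\mathrm{T}(G)$ is infinite dimensional if it contains an infinite linearly independent set. For $u\in\mathrm{T}(G)$ let $N_u=u^{-1}(\{1\})$, which is a closed normal subgroup, and let $N_{\mathrm{Tr}}(G)=\bigcap_{u\in \mathrm{T}(G)}N_u$ (the tracial kernel). $[\mathrm{SIN}]$ is the class of locally compact groups having a neighbourhood base at the identity of conjugation-invariant neighbourhoods; $[\mathrm{MAP}]$ is the class of locally compact groups whose continuous finite-dimensional unitary representations separate points. For $\mathrm{P}\in\{\mathrm{SIN},\mathrm{MAP}\}$, $N_{\mathrm{P}}(G)$ is the intersection of all closed normal subgroups $N$ of $G$ with $G/N\in[\mathrm{P}]$. *)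

(* Defs.v *)
From HB Require Import structures.
From mathcomp Require Import all_boot all_order all_algebra complex spectral.
From mathcomp Require Import all_classical all_reals all_analysis.

Set Implicit Arguments.
Unset Strict Implicit.
Unset Printing Implicit Defensive.

Import Order.TTheory GRing.Theory Num.Theory.
Import numFieldNormedType.Exports.

Local Open Scope classical_set_scope.
Local Open Scope ring_scope.
Local Open Scope complex_scope.

(* R[i] is topologized by its modulus; the library only provides this on the
   alias R[i]^o. *)
HB.instance Definition _ (R : realType) := NormedModule.copy R[i] R[i]^o.

HB.mixin Record isTopologicalGroup G of Topological G & Group G := {
  mulg_continuous : continuous (fun xy : G * G => (xy.1 * xy.2)%g) ;
  invg_continuous : continuous (fun x : G => x^-1%g)
}.

#[short(type="topologicalGroupType")]
HB.structure Definition TopologicalGroup :=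
  {G of isTopologicalGroup G & Topological G & Group G}.

(* The Hausdorff axiom is part of the customary definition. *)
Definition locally_compact_group (G : topologicalGroupType) : Prop :=
  hausdorff_space G /\ locally_compact [set: G].

Record normalSubgroup (G : groupType) := NormalSubgroup {
  nsubg_set :> set G ;
  nsubg1 : nsubg_set 1%g ;
  nsubgM : forall x y, nsubg_set x -> nsubg_set y -> nsubg_set (x * y)%g ;
  nsubgV : forall x, nsubg_set x -> nsubg_set x^-1%g ;
  nsubgJ : forall x y, nsubg_set x -> nsubg_set (x ^ y)%g
}.

Lemma open_mulgr (G : topologicalGroupType) (A : set G) (n : G) :
  open A -> open [set x | A (x * n)%g].
Proof.
move=> oA; have : continuous (fun x : G => (x * n)%g).
  move=> x; apply: (@continuous_comp _ _ _ (fun x : G => (x, n))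
                      (fun xy : G * G => (xy.1 * xy.2)%g)).
    by apply: cvg_pair; [exact: cvg_id | exact: cvg_cst].
  exact: mulg_continuous.
by move/continuousP/(_ A oA).
Qed.

(* G / N as a group of left cosets with the quotient topology. N need not be
   closed here; class_kernel below requires it. *)
Section QuotientGroup.
Local Open Scope group_scope.
Local Open Scope quotient_scope.
Variables (G : topologicalGroupType) (N : normalSubgroup G).

Definition same_coset (x y : G) : bool := `[< nsubg_set N (x^-1 * y) >].

Lemma same_coset_refl : reflexive same_coset.
Proof. by move=> x; apply/asboolP; rewrite mulVg; exact: nsubg1. Qed.

Lemma same_coset_sym : symmetric same_coset.
Proof. by move=> x y; apply/asboolP/asboolP => /nsubgV; rewrite invgM invgK. Qed.

Lemma same_coset_trans : transitive same_coset.
Proof.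
move=> y x z /asboolP xy /asboolP yz; apply/asboolP.
by have := nsubgM xy yz; rewrite mulgA mulgK.
Qed.

Canonical same_coset_equiv :=
  EquivRel same_coset same_coset_refl same_coset_sym same_coset_trans.

Definition quotient_group := quotient_topology {eq_quot same_coset_equiv}.

HB.instance Definition _ := Topological.on quotient_group.
HB.instance Definition _ := Quotient.on quotient_group.

Definition quot_pi (x : G) : quotient_group := \pi_quotient_group x.

Lemma quot_piE (x y : G) : quot_pi x = quot_pi y <-> nsubg_set N (x^-1 * y).
Proof.
split=> [|xy]; first by move/eqquotP/asboolP.
by apply/eqquotP/asboolP.
Qed.

Lemma quot_piK (q : quotient_group) : quot_pi (repr q) = q.
Proof. exact: reprK. Qed.

Definition quot_one : quotient_group := quot_pi 1.
Definition quot_inv (p : quotient_group) : quotient_group :=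
  quot_pi (repr p)^-1.
Definition quot_mul (p q : quotient_group) : quotient_group :=
  quot_pi (repr p * repr q).

Lemma quot_piV x : quot_inv (quot_pi x) = quot_pi x^-1.
Proof.
have /esym/quot_piE xr := quot_piK (quot_pi x).
apply/quot_piE; rewrite invgK.
by have := nsubgJ x^-1 xr; rewrite conjgE invgK !mulgA mulgV mul1g.
Qed.

Lemma quot_piM x y : quot_mul (quot_pi x) (quot_pi y) = quot_pi (x * y).
Proof.
have /quot_piE xr := quot_piK (quot_pi x).
have /quot_piE yr := quot_piK (quot_pi y).
apply/quot_piE.
have := nsubgM (nsubgJ (repr (quot_pi y)) xr) yr.
by rewrite conjgE invgM !mulgA mulgK.
Qed.

Lemma quot_mulA : associative quot_mul.
Proof.
move=> p q r; rewrite -[p]quot_piK -[q]quot_piK -[r]quot_piK.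
by rewrite !quot_piM mulgA.
Qed.

Lemma quot_mul1 : left_id quot_one quot_mul.
Proof. by move=> p; rewrite -[p]quot_piK quot_piM mul1g. Qed.

Lemma quot_mul1r : right_id quot_one quot_mul.
Proof. by move=> p; rewrite -[p]quot_piK quot_piM mulg1. Qed.

Lemma quot_mulV : left_inverse quot_one quot_inv quot_mul.
Proof. by move=> p; rewrite -[p]quot_piK quot_piV quot_piM mulVg. Qed.

Lemma quot_mulVr : right_inverse quot_one quot_inv quot_mul.
Proof. by move=> p; rewrite -[p]quot_piK quot_piV quot_piM mulgV. Qed.

HB.instance Definition _ := isGroup.Build quotient_group
  quot_mulA quot_mul1 quot_mul1r quot_mulV quot_mulVr.

Lemma quot_pi_continuous : continuous quot_pi.
Proof. exact: pi_continuous. Qed.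

Lemma quot_pi_open (A : set G) : open A -> open (quot_pi @` A).
Proof.
move=> oA; change (open (quot_pi @^-1` (quot_pi @` A))).
have -> : quot_pi @^-1` (quot_pi @` A) =
    \bigcup_(n in nsubg_set N) [set x | A (x * n)].
  apply/seteqP; split=> [x [a Aa /esym/quot_piE ax]|x [n Nn Axn]].
    by exists (x^-1 * a) => //=; rewrite mulVKg.
  by exists (x * n) => //; apply/esym/quot_piE; rewrite mulKg.
by apply: bigcup_open => n _; exact: open_mulgr.
Qed.

Lemma quot_mul_continuous :
  continuous (fun pq : quotient_group * quotient_group => pq.1 * pq.2).
Proof.
move=> [p q] U /=.
rewrite -[p]quot_piK -[q]quot_piK.
move: (repr p) (repr q) => x y.
rewrite [X in nbhs X]quot_piM => /quot_pi_continuous Uxy.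
have [[A B] /= [Ax By] ABU] := @mulg_continuous G (x, y) _ Uxy.
exists (quot_pi @` A°, quot_pi @` B°) => /=.
  by split; apply: open_nbhs_nbhs; split;
    do ?[by apply: quot_pi_open; exact: open_interior];
    [exists x | exists y].
move=> [_ _] /= [[a Aa <-] [b Bb <-]]; rewrite /= [_ * _]quot_piM.
by apply: (ABU (a, b)); split; exact: interior_subset.
Qed.

Lemma quot_inv_continuous : continuous (fun p : quotient_group => p^-1).
Proof.
apply/quotient_continuous => x U.
have -> : ((fun p : quotient_group => p^-1) \o \pi_quotient_group) x =
  quot_pi x^-1 by exact: quot_piV.
move=> /quot_pi_continuous/(@invg_continuous G); rewrite !nbhs_filterE.
suff -> : (fun p : quotient_group => p^-1) \o \pi_quotient_group =
  quot_pi \o (fun x => x^-1) by [].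
by apply/funext => y; exact: quot_piV.
Qed.

HB.instance Definition _ := isTopologicalGroup.Build quotient_group
  quot_mul_continuous quot_inv_continuous.

End QuotientGroup.

Section Classes.
Variable R : realType.
Implicit Types G : topologicalGroupType.

Definition SIN G : Prop :=
  locally_compact_group G /\
  forall U : set G, nbhs (1%g : G) U ->
    exists V : set G, [/\ nbhs (1%g : G) V, V `<=` U &
      forall x y : G, V x -> V (x ^ y)%g].

Definition unitary_representation G (n : nat) (rho : G -> 'M[R[i]]_n) : Prop :=
  [/\ rho 1%g = 1%:M,
      forall x y, rho (x * y)%g = rho x *m rho y &
      forall x, rho x \is unitarymx].

Definition MAP G : Prop :=
  locally_compact_group G /\
  forall x y : G, x <> y ->
    exists (n : nat) (rho : G -> 'M[R[i]]_n),
      [/\ unitary_representation rho, continuous rho & rho x <> rho y].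

Definition class_kernel (P : topologicalGroupType -> Prop) G : set G :=
  \bigcap_(N in [set N : normalSubgroup G |
                  closed (nsubg_set N) /\ P (quotient_group N)]) nsubg_set N.

Definition SIN_kernel G : set G := class_kernel SIN (G := G).

Definition MAP_kernel G : set G := class_kernel MAP (G := G).

(* In R[i], 0 <= z means that z is real and nonnegative. *)
Definition positive_definite G (u : G -> R[i]) : Prop :=
  forall (n : nat) (s : 'I_n -> G) (c : 'I_n -> R[i]),
    0 <= \sum_(j < n) \sum_(k < n) (c j)^* * c k * u ((s j)^-1 * s k)%g.

Definition traces G : set (G -> R[i]) :=
  [set u | [/\ continuous u, positive_definite u, u 1%g = 1 &
               forall s t, u (s * t)%g = u (t * s)%g]].

Definition tracial_kernel G : set G :=
  \bigcap_(u in @traces G) (u @^-1` [set 1]).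

End Classes.

Arguments class_kernel P G : clear implicits.
Arguments SIN_kernel G : clear implicits.
Arguments MAP_kernel R G : clear implicits.
Arguments traces R G : clear implicits.
Arguments tracial_kernel R G : clear implicits.

Definition linearly_independent (K : nzRingType) (V : lmodType K)
    (S : set V) : Prop :=
  forall (n : nat) (v : 'I_n -> V) (c : 'I_n -> K),
    injective v -> (forall k, S (v k)) ->
    \sum_(k < n) c k *: v k = 0 -> forall k, c k = 0.

Definition infinite_dimensional (K : nzRingType) (V : lmodType K)
    (T : set V) : Prop :=
  exists S : set V, [/\ S `<=` T, infinite_set S & linearly_independent S].

Definition left_cosets (G : groupType) (H : set G) : set (set G) :=
  range (fun x : G => [set (x * h)%g | h in H]).

Definition infinite_index (G : groupType) (H : set G) : Prop :=
  infinite_set (left_cosets H).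

(* Main.v *)
Require Import Defs.
From mathcomp Require Import all_boot all_order all_algebra complex spectral.
From mathcomp Require Import ring lra.
From mathcomp Require Import all_classical all_reals all_analysis.

(** Part (i) says that traces separate the points of a [SIN] group H. Write
    L_s f for the translate x |-> f (s^-1 x). If I is an integral on H
    invariant under translations and conjugations, and f >= 0 is a continuous
    class function with compact support, then u s = I (f * L_s f) / I (f ^ 2)
    is a trace: it is positive definite because sum_jk c_j^* c_k u (s_j^-1 s_k)
    is the normalized integral of |sum_k c_k L_(s_k) f| ^ 2, and it is central
    because f and I are. When f lives on a neighbourhood W of 1 so small that
    W and y W are disjoint, u y = 0 (SIN_traces_separate). A class function f
    comes from a Urysohn function by taking the supremum over conjugates
    (SIN_central_bump).

    The integral is obtained by Haar's covering construction. For a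
    neighbourhood V of 1 the covering number of f is the least total mass of a
    finite combination of indicators of translates of V lying above f. It is
    subadditive, translation invariant, and conjugation invariant when V is.
    It becomes additive as V shrinks, because a partition of f + g into its
    proportions f / (f + g) and g / (f + g), smoothed by a small constant, is
    almost constant on the translates of a small V
    (covering_number_almost_additive). Invariant V form a base, and a limit of
    normalized covering numbers along an ultrafilter on them is the integral
    (SIN_invariant_integral).

    Parts (ii) and (ii') combine two facts about a G whose set of traces is
    not infinite dimensional. First, every trace u takes finitely many values
    (finite_range_trace): the powers of u are traces, by the Schur product
    theorem, and a linear relation between powers of u is a polynomial
    vanishing on all values of u. In particular u^-1(1) is open. Second, any
    set S of traces contains finitely many members whose being 1 at x forces
    every member of S to be 1 at x (finitely_many_traces_determine): otherwise
    one picks traces u_n and points x_n with u_m (x_n) = 1 for m < n and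
    u_n (x_n) <> 1, and such a sequence is free by triangularity.

    For S the set of all traces these facts make the tracial kernel, and so the
    larger [SIN] kernel, a neighbourhood of 1, hence open. For S the set of
    normalized characters of finite-dimensional unitary representations, the
    points where S is identically 1 lie in the [MAP] kernel. A unitary
    representation whose character has finitely many values has a uniformly
    discrete image in a bounded set of matrices, so finitely many cells of a
    grid classify the elements of G modulo its kernel
    (finite_character_cells). Finitely many representations suffice, so the
    [MAP] kernel has finite index. *)

Set Implicit Arguments.
Unset Strict Implicit.
Unset Printing Implicit Defensive.

Import Order.TTheory GRing.Theory Num.Theory.
Import numFieldNormedType.Exports.

Local Open Scope classical_set_scope.
Local Open Scope complex_scope.
Local Open Scope sesquilinear_scope.
Local Open Scope ring_scope.

(** * A free sequence makes a set infinite dimensional *)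

(** Freeness of the initial segments of a sequence is what arguments by
    induction produce; it passes to arbitrary finite families of distinct terms
    by collecting coefficients of equal index. *)
Lemma independent_infinite_dimensional (K : nzRingType) (V : lmodType K)
    (T : set V) (u : nat -> V) :
    (forall n, T (u n)) ->
    (forall N (a : nat -> K),
      \sum_(i < N) a i *: u i = 0 -> forall i, (i < N)%N -> a i = 0) ->
  infinite_dimensional T.
Proof.
move=> Tu free_u.
have u_inj : injective u.
  move=> i j; wlog lt_ij : i j / (i < j)%N.
    by case: (ltngtP i j) => [lt_ij|lt_ji|//] W E; [exact: W|exact/esym/W].
  move=> uij; suff : 1 = 0 :> K by move/eqP; rewrite oner_eq0.
  have := @free_u j.+1 (fun k => (k == i)%:R - (k == j)%:R).
  move=> /(_ _ i)/=; rewrite eqxx (ltn_eqF lt_ij) subr0; apply.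
    rewrite (eq_bigr (fun k : 'I_j.+1 =>
       (if k == inord i then u k else 0) - (if k == inord j then u k else 0))).
      by rewrite sumrB -!big_mkcond !big_pred1_eq !inordK ?uij ?subrr // ltnS ltnW.
    move=> k _; rewrite scalerBl -!val_eqE /= !inordK //; last by rewrite ltnS ltnW.
    by do 2!case: eqP => _; rewrite ?scale1r ?scale0r.
  by rewrite ltnS ltnW.
exists (range u); split; first by move=> _ [n _ <-].
  move=> fin; apply: infinite_nat.
  have -> : setT = u @^-1` range u by apply/seteqP; split=> // n _; exists n.
  by apply: finite_preimage fin => x y _ _; exact: u_inj.
move=> n v c v_inj rv sum0.
pose m k := sval (cid2 (rv k)).
have mE k : u (m k) = v k by rewrite /m; case: cid2.
have m_inj : injective m.
  by move=> i j mij; apply: v_inj; rewrite -!mE mij.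
move=> k.
pose a i := \sum_(k < n | m k == i) c k.
have -> : c k = a (m k).
  by rewrite /a (big_pred1 k) // => j; rewrite (inj_eq m_inj).
have lt_m j : (m j < (\max_j m j).+1)%N.
  by rewrite ltnS; exact: (@leq_bigmax _ m).
apply: (free_u (\max_j m j).+1) => //.
rewrite -[RHS]sum0 [RHS](partition_big
  (fun k => inord (m k) : 'I_(\max_j m j).+1) predT) //=.
apply: eq_bigr => i _; rewrite /a scaler_suml; apply: eq_big => [j|j /eqP <-].
  by rewrite -val_eqE /= inordK.
by rewrite mE.
Qed.

(** * Products of positive definite functions *)

Section Traces.
Variables (R : realType) (G : topologicalGroupType).
Implicit Types u v : G -> R[i].

(** Polarization: with a = u s and b = u s^-1, positivity on the points 1 and s
    makes z^* a + z b real, and z = 1 and z = 'i then force b = a^*. *)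
Lemma positive_definite_hermitian u : positive_definite u ->
  forall s, u s^-1%g = (u s)^*.
Proof.
move=> pd s.
have real_form z w : (z^* * w * u s + w^* * z * u s^-1%g) + (z^* * z + w^* * w) * u 1%g
    \is Num.real.
  set B := _ + _ + _.
  have := pd 2%N (fun k : 'I_2 => if k == 0 then 1%g else s)
                 (fun k : 'I_2 => if k == 0 then z else w).
  set A := bigop.body _ _ _.
  suff -> : A = B by move/ger0_real.
  rewrite /A /B !big_ord_recl !big_ord0 /= !(invg1, mul1g, mulg1, mulVg).
  ring.
have u1 : u 1%g \is Num.real.
  have := pd 1%N (fun=> 1%g) (fun=> 1).
  by rewrite !big_ord_recl !big_ord0 /= conjC1 invg1 !(mul1g, mul1r, addr0) => /ger0_real.
have real_part z : z^* * u s + z * u s^-1%g \is Num.real.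
  have := real_form z 1; rewrite conjC1 !mul1r mulr1 => h.
  rewrite -[X in X \is _](addrK ((z^* * z + 1) * u 1%g)) rpredB // rpredM //.
  by apply: ger0_real; rewrite addr_ge0 ?ler01 // mulrC mul_conjC_ge0.
have := CrealP (real_part 1); have := CrealP (real_part 'i).
rewrite !(rmorphD, rmorphM) /= !conjCK conjCi conjC1 !mul1r.
have II : 'i * 'i = -1 :> R[i] by rewrite -expr2 sqrCi.
set a := u s; set b := u s^-1%g => e2 e1.
have {}e2 : b^* - a^* = a - b.
  have : 'i * ('i * a^* + - 'i * b^*) = 'i * (- 'i * a + 'i * b) by rewrite e2.
  by rewrite !mulrDr !mulrA !mulrN II !mulN1r !opprK !mul1r => e; rewrite addrC e.
have : b^* *+ 2 = a *+ 2.
  by rewrite !mulr2n -{1}(subrK a^* b^*) e2 -addrA e1; ring.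
by move/eqP; rewrite eqrMn2r //= => /eqP <-; rewrite conjCK.
Qed.

(** The Schur product theorem. Diagonalizing the Gram matrix of u as a sum of
    rank-one forms with weights d_l >= 0 turns the form of u v into the sum over
    l of d_l times the form of v at rescaled coefficients. *)
Lemma positive_definiteM u v : positive_definite u -> positive_definite v ->
  positive_definite (fun x => u x * v x).
Proof.
move=> pdu pdv n s c.
pose M : 'M[R[i]]_n := \matrix_(j, k) u ((s j)^-1 * s k)%g.
have hM : M ^t* = M.
  apply/matrixP => j k; rewrite !mxE -(positive_definite_hermitian pdu).
  by rewrite invgM invgK.
have /orthomx_spectralP : M \is normalmx by apply/normalmxP; rewrite hM.
have := spectral_unitarymx M.
set P := spectralmx M; set d := spectral_diag M => uP ME.
have iP := invmx_unitary uP.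
have MjkE j k : M j k = \sum_l d 0 l * ((P l j)^* * P l k).
  rewrite ME iP mul_mx_diag !mxE; apply: eq_bigr => l _.
  by rewrite !mxE; ring.
have dE : diag_mx d = P *m M *m P ^t*.
  by rewrite ME !mulmxA -iP (mulmxK (unitarymx_unit uP)) mulmxV ?mul1mx
    ?unitarymx_unit.
have d_ge0 l : 0 <= d 0 l.
  have -> : d 0 l = (diag_mx d) l l by rewrite mxE eqxx.
  rewrite dE; have := pdu n s (fun j => (P l j)^*).
  set A := bigop.body _ _ _.
  suff -> : A = (P *m M *m P ^t*) l l by exact.
  rewrite !mxE /A exchange_big; apply: eq_bigr => k _ /=.
  by rewrite !mxE mulr_suml; apply: eq_bigr => j _; rewrite !mxE conjCK; ring.
set A := bigop.body _ _ _.
suff -> : A = \sum_l d 0 l * \sum_(j < n) \sum_(k < n)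
    (P l j * c j)^* * (P l k * c k) * v ((s j)^-1 * s k)%g.
  by apply: sumr_ge0 => l _; rewrite mulr_ge0.
under [RHS]eq_bigr => l _ do rewrite mulr_sumr.
rewrite [RHS]exchange_big; apply: eq_bigr => j _ /=.
under [RHS]eq_bigr => l _ do rewrite mulr_sumr.
rewrite [RHS]exchange_big; apply: eq_bigr => k _ /=.
have -> : u ((s j)^-1 * s k)%g = M j k by rewrite mxE.
rewrite MjkE mulr_suml mulr_sumr; apply: eq_bigr => l _; rewrite rmorphM /=.
ring.
Qed.

Lemma trace1 : traces R G (fun=> 1).
Proof.
split=> //; first by move=> x; exact: cvg_cst.
move=> n s c; set A := bigop.body _ _ _.
suff -> : A = (\sum_(j < n) c j)^* * (\sum_(j < n) c j).
  by rewrite mulrC mul_conjC_ge0.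
rewrite rmorph_sum mulr_suml; apply: eq_bigr => j _; rewrite mulr_sumr.
by apply: eq_bigr => k _; rewrite mulr1.
Qed.

Lemma traceM u v : traces R G u -> traces R G v ->
  traces R G (fun x => u x * v x).
Proof.
move=> [cu pu u1 tu] [cv pv v1 tv]; split.
- by move=> x; apply: cvgM; [exact: cu|exact: cv].
- exact: positive_definiteM.
- by rewrite u1 v1 mulr1.
- by move=> s t; rewrite tu tv.
Qed.

Lemma traceX u n : traces R G u -> traces R G (fun x => u x ^+ n).
Proof.
move=> tu; elim: n => [|n IHn]; first exact: trace1.
rewrite (_ : (fun x => _) = fun x => u x * u x ^+ n); first exact: traceM.
by apply/funext => x; rewrite exprS.
Qed.

(** * Traces when they span a finite-dimensional space *)

Section FiniteDimension.
Hypothesis fin_dim : ~ infinite_dimensional (traces R G : set (G -> R[i])).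

(** A polynomial that vanishes on an infinite range is zero, so infinitely
    many values would make the powers of u free. *)
Lemma finite_range_trace u : traces R G u -> finite_set (range u).
Proof.
move=> tu; apply: contrapT => inf_u; apply: fin_dim.
apply: (independent_infinite_dimensional
          (u := fun n x => u x ^+ n : R[i])) => [n|N a sum0 i ltiN].
  exact: traceX.
have p_root x : root (\poly_(i < N) a i) (u x).
  rewrite rootE horner_poly; apply/eqP.
  transitivity ((\sum_(i < N) a i *: (fun x => u x ^+ i) : G -> R[i]) x).
    by rewrite fct_sumE; apply: eq_bigr.
  by rewrite sum0.
have p0 : \poly_(i < N) a i = 0.
  apply: contrapT => /eqP p_neq0; apply: inf_u.
  have [r pE] := closed_field_poly_normal (\poly_(i < N) a i).
  apply: sub_finite_set (finite_seq r) => _ [x _ <-] /=.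
  by have := p_root x; rewrite pE rootZ ?lead_coef_eq0 // root_prod_XsubC.
by have := coef_poly N a i; rewrite p0 coef0 ltiN => <-.
Qed.

(** Removing 1 from a finite range leaves a closed set. *)
Lemma open_trace_kernel u : traces R G u -> open (u @^-1` [set 1]).
Proof.
move=> tu; have [cu _ _ _] := tu.
have -> : u @^-1` [set 1] = u @^-1` (~` (range u `\ 1)).
  apply/seteqP; split=> x /=; first by move=> -> [].
  by move=> h; apply: contrapT => ux; apply: h; split=> //; exists x.
move/continuousP : cu; apply; rewrite openC.
apply: (accessible_finite_set_closed.1 _).
  exact/hausdorff_accessible/norm_hausdorff.
by apply: finite_setD; exact: finite_range_trace.
Qed.

(** If no finite part of S determines where S is 1, dependent choice gives
    u_n in S and points x_n with u_m (x_n) = 1 for m < n but u_n (x_n) <> 1.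
    Comparing a linear relation at x_n and at the identity, where all traces
    are 1, kills its last coefficient. *)
Lemma finitely_many_traces_determine (S : set (G -> R[i])) :
    S `<=` traces R G ->
  exists2 l : seq (G -> R[i]), (forall v, List.In v l -> S v) &
    forall x, (forall v, List.In v l -> v x = 1) -> forall u, S u -> u x = 1.
Proof.
move=> S_traces; apply: contrapT => no_l; apply: fin_dim.
(* Lists of members of S are bundled with their membership proof, so that
   the choice of the next trace can be iterated as a plain function. *)
have step (l : {l : seq (G -> R[i]) | forall v, List.In v l -> S v}) :
    {ux : (G -> R[i]) * G | [/\ S ux.1, ux.1 ux.2 <> 1 &
      forall v, List.In v (sval l) -> v ux.2 = 1]}.
  apply: cid; case: l => l lS /=; apply: contrapT => no_ux; apply: no_l.
  exists l => // x lx u Su; apply: contrapT => ux; apply: no_ux.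
  by exists (u, x).
have extP l : forall v, List.In v ((sval (step l)).1 :: sval l) -> S v.
  by move=> v [<-|]; [case: (svalP (step l))|exact: (svalP l)].
pose ext l := exist (fun l => forall v, List.In v l -> S v) _ (extP l).
have nilP : forall v, List.In v [::] -> S v by [].
pose L n := iter n ext (exist (fun l => forall v, List.In v l -> S v) _ nilP).
pose u n := (sval (step (L n))).1; pose x n := (sval (step (L n))).2.
have Su n : S (u n) by case: (svalP (step (L n))).
have uxn n : u n (x n) <> 1 by case: (svalP (step (L n))).
have uL m n : (m < n)%N -> List.In (u m) (sval (L n)).
  elim: n => // n IHn; rewrite ltnS leq_eqVlt => /predU1P[->|/IHn].
    by left.
  by right.
have ux m n : (m < n)%N -> u m (x n) = 1.
  by move=> /uL; case: (svalP (step (L n))) => _ _; exact.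
apply: (independent_infinite_dimensional (u := u)).
  by move=> n; exact: S_traces.
move=> N a; elim: N => // N IHN sum0.
have ev y : \sum_(i < N.+1) a i * u i y = 0.
  transitivity ((\sum_(i < N.+1) a i *: u i) y); last by rewrite sum0.
  by rewrite fct_sumE; apply: eq_bigr.
have aN : a N = 0.
  have := ev 1%g; rewrite -[RHS](ev (x N)) !big_ord_recr /=.
  rewrite (eq_bigr (fun i : 'I_N => a i)); last first.
    by move=> i _; have [_ _ -> _] := S_traces _ (Su i); rewrite mulr1.
  rewrite [in RHS](eq_bigr (fun i : 'I_N => a i)); last first.
    by move=> i _; rewrite ux // mulr1.
  have [_ _ -> _] := S_traces _ (Su N).
  move=> /addrI/eqP; rewrite -subr_eq0 -mulrBr mulf_eq0 subr_eq0.
  by case/orP => /eqP // /esym /uxn.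
move=> i; rewrite ltnS leq_eqVlt => /predU1P[->//|ltiN].
by apply: IHN => //; move: sum0; rewrite big_ord_recr /= aN scale0r addr0.
Qed.

End FiniteDimension.

End Traces.

(** * Continuous functions with compact support on a group *)

Section TopologicalGroupContinuity.
Variable H : topologicalGroupType.
Implicit Types a t x : H.

Lemma continuous_mulgl a : continuous (fun x : H => (a * x)%g).
Proof.
move=> x; apply: (@continuous_comp _ _ _ (fun x : H => (a, x))
                    (fun xy : H * H => (xy.1 * xy.2)%g)).
  by apply: cvg_pair; [exact: cvg_cst|exact: cvg_id].
exact: mulg_continuous.
Qed.

Lemma continuous_mulgr a : continuous (fun x : H => (x * a)%g).
Proof.
move=> x; apply: (@continuous_comp _ _ _ (fun x : H => (x, a))
                    (fun xy : H * H => (xy.1 * xy.2)%g)).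
  by apply: cvg_pair; [exact: cvg_id|exact: cvg_cst].
exact: mulg_continuous.
Qed.

Lemma nbhs1_translate (V : set H) a :
  nbhs (1%g : H) V -> \forall x \near a, V (a^-1 * x)%g.
Proof.
by move=> V1; have := @continuous_mulgl a^-1%g a; apply; rewrite mulVg.
Qed.

End TopologicalGroupContinuity.

(** Compactness is used as a near-covering property, along the filter of finite
    lists ordered by inclusion. *)
Lemma compact_finite_translates (H : topologicalGroupType) (K V : set H) :
    compact K -> nbhs (1%g : H) V ->
  exists l : seq H, forall x, K x -> exists2 s, s \in l & V (s^-1 * x)%g.
Proof.
move=> /compact_near_coveringP cK V1.
pose F := filter_from setT (fun l : seq H => [set l' : seq H | {subset l <= l'}]).
have FF : ProperFilter F.
  apply: filter_from_proper; last by move=> l _; exists l => //=.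
  apply: filter_from_filter; first by exists [::].
  move=> l1 l2 _ _; exists (l1 ++ l2) => // l sub.
  by split=> x xl; apply: sub; rewrite mem_cat xl ?orbT.
(* A point x is covered as soon as the list contains x itself. *)
have nF : \forall l \near F,
    K `<=` (fun x => exists2 s, s \in l & V (s^-1 * x)%g).
  apply: (cK _ F (fun l x => exists2 s, s \in l & V (s^-1 * x)%g)) => x Kx.
  exists ([set x' | V (x^-1 * x')%g], [set l : seq H | x \in l]).
    split=> /=; first exact: nbhs1_translate.
    by exists [:: x] => // l; apply; rewrite inE.
  by move=> [x' l] /= [Vx' xl]; exists x.
by have [l lP] := @filter_ex _ F FF _ nF; exists l.
Qed.

Section CompactSupport.
Variables (R : realType) (H : topologicalGroupType).
Implicit Types (f g : H -> R) (K V : set H).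

Definition compactly_supported f :=
  continuous f /\ exists2 K, compact K & forall x, ~ K x -> f x = 0.

Lemma compactly_supportedD f g : compactly_supported f ->
  compactly_supported g -> compactly_supported (fun x => f x + g x).
Proof.
move=> [cf [K cK fK]] [cg [L cL gL]]; split.
  by move=> x; apply: cvgD; [exact: cf|exact: cg].
exists (K `|` L); first exact: compactU.
by move=> x /not_orP[/fK -> /gL ->]; rewrite addr0.
Qed.

Lemma compactly_supportedM f g : compactly_supported f -> continuous g ->
  compactly_supported (fun x => f x * g x).
Proof.
move=> [cf [K cK fK]] cg; split.
  by move=> x; apply: cvgM; [exact: cf|exact: cg].
by exists K => // x /fK ->; rewrite mul0r.
Qed.

Lemma compactly_supportedZ c f : compactly_supported f ->
  compactly_supported (fun x => c * f x).
Proof.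
move=> cf; rewrite (_ : (fun x => _) = fun x => f x * c); last first.
  by apply/funext => x; rewrite mulrC.
by apply: compactly_supportedM => // x; exact: cvg_cst.
Qed.

Lemma compactly_supported_comp f (phi psi : H -> H) :
    continuous phi -> continuous psi -> cancel phi psi ->
  compactly_supported f -> compactly_supported (f \o phi).
Proof.
move=> cphi cpsi phiK [cf [K cK fK]]; split.
  by move=> x; apply: continuous_comp; [exact: cphi|exact: cf].
exists (psi @` K).
  by apply: continuous_compact cK; exact: continuous_subspaceT.
by move=> x nKx; apply: fK => Kx; apply: nKx; exists (phi x).
Qed.

Lemma compactly_supported_translate f t : compactly_supported f ->
  compactly_supported (fun x => f (t * x)%g).
Proof.
apply: (compactly_supported_comp (psi := fun x => (t^-1 * x)%g)).
- exact: continuous_mulgl.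
- exact: continuous_mulgl.
- by move=> x; rewrite mulKg.
Qed.

Lemma compactly_supported_bounded f : compactly_supported f ->
  exists M K, [/\ 0 <= M, compact K & forall x, f x <= M * \1_K x].
Proof.
move=> [cf [K cK fK]].
have : compact (f @` K).
  by apply: continuous_compact cK; exact: continuous_subspaceT.
move/(@compact_bounded _ R^o) => /ex_strict_bound_gt0 [M0 M0gt0 MP].
exists M0, K; split=> [||x]; rewrite ?(ltW M0gt0) // indicE.
have [|/negP Kx] := boolP (x \in K).
  rewrite inE mulr1 => Kx; apply: le_trans (ler_norm _) _.
  by apply: ltW; apply: MP; exists x.
by rewrite mulr0 fK // => Kx'; apply: Kx; rewrite inE.
Qed.

(** Heine-Cantor for right translations. Points outside the support K are
    handled by moving x v back into K with v^-1. *)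
Lemma compactly_supported_uniform f (e : R) : compactly_supported f -> 0 < e ->
  \forall v \near (1%g : H), forall x, `|f (x * v)%g - f x| < e.
Proof.
move=> [cf [K /compact_near_coveringP cK fK]] e0.
pose P (v x : H) : Prop := `|f (x * v)%g - f x| < e.
have near_P (x : H) : \forall x' \near x & v \near (1%g : H), P v x'.
  have : (f (xv.1 * xv.2)%g - f xv.1) @[xv --> (x, 1%g : H)] -->
         f (x * 1)%g - f x.
    have c1 : f xv.1 @[xv --> (x, 1%g : H)] --> f x.
      by apply: (@cvg_comp _ _ _ fst f); [exact: cvg_fst|exact: cf].
    have c2 : f (xv.1 * xv.2)%g @[xv --> (x, 1%g : H)] --> f (x * 1)%g.
      apply: (@cvg_comp _ _ _ (fun xv : H * H => xv.1 * xv.2)%g f); last exact: cf.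
      exact: (@mulg_continuous H (x, 1%g)).
    exact: cvgB c2 c1.
  move/cvgrPdist_lt => /(_ e e0) /=; rewrite mulg1 subrr.
  by apply: filterS => -[x' v] /=; rewrite sub0r normrN.
have near_K : \forall v \near (1%g : H), K `<=` P v.
  by apply: (cK H (nbhs (1%g : H)) P) => x _; exact: near_P.
(* This covers the points x with x v in K, for which x = (x v) v^-1. *)
have near_KV : \forall v \near (1%g : H), K `<=` P v^-1%g.
  by apply: (@invg_continuous H 1%g (fun v => K `<=` P v)); rewrite invg1.
near=> v => x; have [Kx|/fK fx0] := pselect (K x).
  by apply: (near near_K v).
have [Kxv|/fK fxv0] := pselect (K (x * v)%g); last by rewrite fx0 fxv0 subrr normr0.
have := near near_KV v _ _ Kxv; rewrite /P mulgK distrC; exact.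
Unshelve. all: by end_near. Qed.

End CompactSupport.

(** * Haar covering numbers *)

Section CoveringNumber.
Variables (R : realType) (H : groupType) (V : set H).
Implicit Types (s : seq (R * H)) (f g : H -> R).

Definition step_function s x : R :=
  \sum_(cs <- s) cs.1 * \1_V (cs.2^-1 * x)%g.

Definition mass s : R := \sum_(cs <- s) cs.1.

Definition dominates s f :=
  all (fun cs => 0 <= cs.1) s /\ forall x, f x <= step_function s x.

Definition dominated f := exists s, dominates s f.

(** Haar's covering number (f : V), in the version where V is a set rather
    than a bump function and where the covering may have real weights. When f is
    dominated, the infimum is over a nonempty set bounded below by 0. *)
Definition covering_number f : R := inf [set mass s | s in dominates^~ f].

Lemma mass_ge0 s : all (fun cs => 0 <= cs.1) s -> 0 <= mass s.
Proof. by move=> s0; rewrite /mass big_seq sumr_ge0 // => cs /(allP s0). Qed.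

Lemma covering_number_le s f : dominates s f -> covering_number f <= mass s.
Proof.
move=> sf; apply: ge_inf; last by exists s.
by exists 0 => _ [t [t0 _] <-]; exact: mass_ge0.
Qed.

Lemma le_covering_number f b : dominated f ->
  (forall s, dominates s f -> b <= mass s) -> b <= covering_number f.
Proof.
move=> [s sf] bP; apply: lb_le_inf; first by exists (mass s), s.
by move=> _ [t tf <-]; exact: bP.
Qed.

Lemma covering_number_ge0 f : dominated f -> 0 <= covering_number f.
Proof. by move=> df; apply: le_covering_number => // s [/mass_ge0]. Qed.

Lemma dominatesS s f g : (forall x, f x <= g x) ->
  dominates s g -> dominates s f.
Proof. by move=> fg [s0 sg]; split=> // x; apply: le_trans (fg x) (sg x). Qed.

Lemma dominatedS f g : (forall x, f x <= g x) -> dominated g -> dominated f.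
Proof. by move=> fg [s /(dominatesS fg)]; exists s. Qed.

Lemma covering_numberS f g : (forall x, f x <= g x) -> dominated g ->
  covering_number f <= covering_number g.
Proof.
by move=> fg dg; apply: le_covering_number => // s /(dominatesS fg)/covering_number_le.
Qed.

Lemma dominatesD s t f g : dominates s f -> dominates t g ->
  dominates (s ++ t) (fun x => f x + g x).
Proof.
move=> [s0 sf] [t0 tg]; split; first by rewrite all_cat s0.
by move=> x; rewrite /step_function big_cat lerD.
Qed.

Lemma dominatedD f g : dominated f -> dominated g ->
  dominated (fun x => f x + g x).
Proof. by move=> [s sf] [t tg]; exists (s ++ t); exact: dominatesD. Qed.

Lemma covering_numberD f g : dominated f -> dominated g ->
  covering_number (fun x => f x + g x) <= covering_number f + covering_number g.
Proof.
move=> df dg; rewrite -lerBlDr; apply: le_covering_number => // s sf.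
rewrite lerBlDr -lerBlDl; apply: le_covering_number => // t tg.
by rewrite lerBlDl -[mass s + _]big_cat; exact/covering_number_le/dominatesD.
Qed.

Lemma dominatesZ c s f : 0 <= c -> dominates s f ->
  dominates [seq (c * cs.1, cs.2) | cs <- s] (fun x => c * f x).
Proof.
move=> c0 [/allP s0 sf]; split.
  by apply/allP => _ /mapP[cs /s0 cs0 ->]; exact: mulr_ge0.
move=> x; rewrite /step_function big_map /=.
under eq_bigr => cs _ do rewrite -mulrA.
by rewrite -mulr_sumr ler_wpM2l.
Qed.

Lemma massZ c s : mass [seq (c * cs.1, cs.2) | cs <- s] = c * mass s.
Proof. by rewrite /mass big_map mulr_sumr. Qed.

Lemma dominatedZ c f : 0 <= c -> dominated f -> dominated (fun x => c * f x).
Proof. by move=> c0 [s /(dominatesZ c0) sf]; eexists; exact: sf. Qed.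

Lemma covering_numberZ c f : 0 <= c -> dominated f ->
  covering_number (fun x => c * f x) = c * covering_number f.
Proof.
have leZ d h : 0 < d -> dominated h ->
    covering_number (fun x => d * h x) <= d * covering_number h.
  move=> d0 dh; rewrite -ler_pdivrMl //; apply: le_covering_number => // s sh.
  by rewrite ler_pdivrMl // -massZ; exact/covering_number_le/dominatesZ/sh/ltW.
rewrite le_eqVlt => /predU1P[<- df|c0 df].
  (* For c = 0 the empty covering has mass 0. *)
  rewrite mul0r; apply/eqP; rewrite eq_le covering_number_ge0 ?andbT; last first.
    exact: dominatedZ.
  rewrite -[leRHS](@big_nil R 0 +%R _ (fun=> true) (fun cs : R * H => cs.1)).
  by apply: covering_number_le; split=> // x; rewrite /step_function big_nil mul0r.
apply/eqP; rewrite eq_le leZ //=.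
have dcf := dominatedZ (ltW c0) df.
rewrite -ler_pdivlMl // ; apply: le_trans (leZ _ _ _ dcf); last by rewrite invr_gt0.
apply: covering_numberS; last by apply: dominatedZ => //; rewrite invr_ge0 ltW.
by move=> x; rewrite mulrA mulVf ?mul1r // gt_eqF.
Qed.

Lemma dominates_translate s f t : dominates s f ->
  dominates [seq (cs.1, (t^-1 * cs.2)%g) | cs <- s] (fun x => f (t * x)%g).
Proof.
move=> [/allP s0 sf]; split; first by apply/allP => _ /mapP[cs /s0 cs0 ->].
move=> x; apply: le_trans (sf _) _; rewrite /step_function big_map /=.
by apply: ler_sum => cs _; rewrite invgM invgK mulgA.
Qed.

Lemma covering_number_translate f t : dominated f ->
  covering_number (fun x => f (t * x)%g) = covering_number f.
Proof.
have le_transl h a : dominated h ->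
    covering_number (fun x => h (a * x)%g) <= covering_number h.
  move=> dh; apply: le_covering_number => // s sh.
  apply: le_trans (covering_number_le (dominates_translate a sh)) _.
  by rewrite /mass big_map.
move=> df; apply/eqP; rewrite eq_le le_transl //=.
have dtf : dominated (fun x => f (t * x)%g).
  by have [s /(dominates_translate t) sf] := df; eexists; exact: sf.
have := le_transl _ t^-1%g dtf.
rewrite [X in covering_number X <= _ -> _](_ : _ = f) //.
by apply/funext => x; rewrite mulVKg.
Qed.

Lemma dominates_conj s f t : (forall x y, V x -> V (x ^ y)%g) ->
  dominates s f ->
  dominates [seq (cs.1, (cs.2 ^ t^-1)%g) | cs <- s] (fun x => f (x ^ t)%g).
Proof.
move=> VJ [/allP s0 sf]; split; first by apply/allP => _ /mapP[cs /s0 cs0 ->].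
move=> x; apply: le_trans (sf _) _; rewrite /step_function big_map /=.
apply: ler_sum => cs _.
suff -> : \1_V ((cs.2 ^ t^-1)^-1 * x)%g = \1_V (cs.2^-1 * x ^ t)%g :> R by [].
have -> : ((cs.2 ^ t^-1)^-1 * x = (cs.2^-1 * x ^ t) ^ t^-1)%g.
  by rewrite conjMg conjgK conjVg.
rewrite !indicE; congr ((_ : bool)%:R).
by apply/idP/idP; rewrite !inE => /VJ; [move/(_ t); rewrite conjgKV|exact].
Qed.

Lemma covering_number_conj f t : (forall x y, V x -> V (x ^ y)%g) ->
  dominated f -> covering_number (fun x => f (x ^ t)%g) = covering_number f.
Proof.
move=> VJ.
have le_conj h a : dominated h ->
    covering_number (fun x => h (x ^ a)%g) <= covering_number h.
  move=> dh; apply: le_covering_number => // s sh.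
  apply: le_trans (covering_number_le (dominates_conj a VJ sh)) _.
  by rewrite /mass big_map.
move=> df; apply/eqP; rewrite eq_le le_conj //=.
have dtf : dominated (fun x => f (x ^ t)%g).
  by have [s /(dominates_conj t VJ) sf] := df; eexists; exact: sf.
have := le_conj _ t^-1%g dtf.
rewrite [X in covering_number X <= _ -> _](_ : _ = f) //.
by apply/funext => x; rewrite conjgKV.
Qed.

(** Every indicator is at most 1; this keeps the normalizing covering number
    away from 0. *)
Lemma value_le_covering_number f x : dominated f -> f x <= covering_number f.
Proof.
move=> df; apply: le_covering_number => // s [/allP s0 /(_ x) sfx].
apply: le_trans sfx _; rewrite /step_function /mass !big_seq.
by apply: ler_sum => cs /s0 cs0; rewrite ler_piMr // indicE.
Qed.

(** This is the comparison that bounds the ratio of two covering numbers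
    independently of V. *)
Lemma covering_number_translates (h : H -> R) f b (l : seq H) :
    0 <= b -> dominated h ->
    (forall x, f x <= \sum_(t <- l) b * h (t^-1 * x)%g) ->
  covering_number f <= (size l)%:R * b * covering_number h.
Proof.
move=> b0 dh.
have dt t : dominated (fun x => b * h (t^-1 * x)%g).
  apply: dominatedZ => //.
  by have [s /(dominates_translate t^-1%g) sf] := dh; eexists; exact: sf.
elim: l f => [|t l IHl] f le_f.
  rewrite !mul0r.
  rewrite -[leRHS](@big_nil R 0 +%R _ (fun=> true) (fun cs : R * H => cs.1)).
  apply: covering_number_le; split=> // x.
  by apply: le_trans (le_f x) _; rewrite /step_function !big_nil.
pose g x := \sum_(t <- l) b * h (t^-1 * x)%g.
have dg : dominated g.
  rewrite /g; elim: l {IHl le_f g} => [|u l IHl].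
    by exists [::]; split=> // x; rewrite /step_function !big_nil.
  apply: dominatedS (dominatedD (dt u) IHl) => x.
  by rewrite big_cons.
apply: (@le_trans _ _ (covering_number (fun x => b * h (t^-1 * x)%g + g x))).
  apply: covering_numberS; last exact: dominatedD.
  by move=> x; apply: le_trans (le_f x) _; rewrite big_cons.
apply: le_trans (covering_numberD (dt t) dg) _.
rewrite /= -natr1 mulrDl mul1r mulrDl addrC lerD //; first exact: IHl.
have dth : dominated (fun x => h (t^-1 * x)%g).
  by have [s /(dominates_translate t^-1%g) sf] := dh; eexists; exact: sf.
by rewrite covering_numberZ // covering_number_translate.
Qed.

End CoveringNumber.

(** * Covering numbers become additive on small neighbourhoods *)

Section HaarFunctional.
Variables (R : realType) (H : topologicalGroupType).
Implicit Types (f g : H -> R) (K V : set H).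

Lemma indic_le_translates K V : compact K -> nbhs (1%g : H) V ->
  exists l : seq H, forall x, \1_K x <= \sum_(t <- l) \1_V (t^-1 * x)%g :> R.
Proof.
move=> cK V1; have [l lP] := compact_finite_translates cK V1.
exists l => x; rewrite [leLHS]indicE; have [|_] := boolP (x \in K); last first.
  by rewrite sumr_ge0 // => t _; rewrite indicE.
rewrite inE => /lP[s sl Vsx]; rewrite (big_rem s) //= indicE mem_set //.
by rewrite lerDl sumr_ge0 // => t _; rewrite indicE.
Qed.

Lemma compactly_supported_dominated f V : compactly_supported f ->
  nbhs (1%g : H) V -> dominated V f.
Proof.
move=> /compactly_supported_bounded[M [K [M0 cK fM]]] V1.
have [l lP] := indic_le_translates cK V1.
exists [seq (M, t) | t <- l]; split.
  by apply/allP => _ /mapP[t _ ->].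
move=> x; apply: le_trans (fM x) _.
by rewrite /step_function big_map /= -mulr_sumr ler_wpM2l.
Qed.

(** K is covered by translates of the set where phi > 1/2, so a function
    bounded by M on K lies below 2 M times a fixed finite sum of translates of
    phi. The constant depends on K only, which lets it survive the limit over V
    and serve functions that vary with an auxiliary parameter. *)
Lemma covering_number_compact_bound (phi : H -> R) K :
    continuous phi -> (forall x, 0 <= phi x) -> phi 1%g = 1 -> compact K ->
  exists2 C, 0 <= C & forall V f M, dominated V phi -> 0 <= M ->
    (forall x, f x <= M * \1_K x) ->
    covering_number V f <= M * C * covering_number V phi.
Proof.
move=> cphi phi0 phi1 cK.
pose W := [set x | 2^-1 < phi x].
have W1 : nbhs (1%g : H) W.
  have half : 2^-1 < phi 1%g by rewrite phi1; lra.
  exact: (cvgr_gt (phi 1%g) (cphi 1%g) _ half).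
have [l lP] := indic_le_translates cK W1.
exists ((size l)%:R * 2) => [|V f M dphi M0 fM]; first exact: mulr_ge0.
rewrite (_ : M * _ = (size l)%:R * (M * 2)); last by ring.
apply: covering_number_translates => // [|x]; first exact: mulr_ge0.
apply: le_trans (fM x) _; rewrite -mulr_sumr -mulrA ler_wpM2l //.
apply: le_trans (lP x) _; rewrite mulr_sumr; apply: ler_sum => t _.
rewrite indicE; have [|_] := boolP (_ \in W); last exact: mulr_ge0.
rewrite inE /W /= => h; lra.
Qed.

(** On a translate t V the function h differs from h t by at most e, so
    multiplying a covering of g by h multiplies its weights by at most
    h t + e. *)
Lemma weighted_covering_number_le V f g h e s :
    0 < e -> (forall x v, V v -> `|h (x * v)%g - h x| <= e) ->
    (forall x, 0 <= h x) ->
    (forall x, f x = (g x + e) * h x) -> dominated V h -> dominates V s g ->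
  covering_number V f <=
    \sum_(cs <- s) cs.1 * (h cs.2 + e) + e * covering_number V h.
Proof.
move=> e0 hV h0 fE dh [/allP s0 sg].
pose s' := [seq (cs.1 * (h cs.2 + e), cs.2) | cs <- s].
have s'P : dominates V s' (fun x => g x * h x).
  split.
    apply/allP => _ /mapP[cs /s0 cs0 ->] /=.
    by rewrite mulr_ge0 // addr_ge0 // ltW.
  move=> x; apply: (@le_trans _ _ (step_function V s x * h x)).
    by rewrite ler_wpM2r.
  rewrite /step_function big_map mulr_suml !big_seq; apply: ler_sum => cs /s0 cs0.
  rewrite /= mulrAC -!mulrA ler_wpM2l // indicE.
  have [|_] := boolP (_ \in V); last by rewrite !mulr0.
  rewrite inE => /(hV cs.2); rewrite mulVKg !mulr1 => /ler_normlW; lra.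
have -> : f = fun x => g x * h x + e * h x.
  by apply/funext => x; rewrite fE mulrDl.
have ds' : dominated V (fun x => g x * h x) by exists s'.
apply: le_trans (covering_numberD ds' (dominatedZ (ltW e0) dh)) _.
rewrite (covering_numberZ (ltW e0) dh) lerD2r.
by apply: le_trans (covering_number_le s'P) _; rewrite /mass big_map.
Qed.

(** With F = f + g + e, the proportions h1 = f / F and h2 = g / F are
    uniformly continuous and add up to at most 1. A covering of f + g by small
    translates, reweighted by h1 and by h2, covers f and g at almost no extra
    cost. The term e in F makes the division harmless and costs e times
    the covering numbers of h1 and h2, which are bounded in terms of phi because
    h1 and h2 are at most 1 on a compact set independent of e. *)
Lemma covering_number_almost_additive (phi f g : H -> R) :
    (forall x, 0 <= phi x) -> phi 1%g = 1 ->
    compactly_supported phi -> compactly_supported f -> compactly_supported g ->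
    (forall x, 0 <= f x) -> (forall x, 0 <= g x) ->
  exists2 C, 0 <= C & forall e, 0 < e ->
    exists2 W, nbhs (1%g : H) W & forall V, nbhs (1%g : H) V -> V `<=` W ->
      covering_number V f + covering_number V g <=
        (1 + e) * covering_number V (fun x => f x + g x)
        + e * C * covering_number V phi.
Proof.
move=> phi0 phi1 csphi csf csg f0 g0.
have [cf [Kf cKf fK]] := csf; have [cg [Kg cKg gK]] := csg.
have [C C0 CP] := covering_number_compact_bound csphi.1 phi0 phi1 (compactU cKf cKg).
(* The error 2 e comes from adding h1 + e and h2 + e. *)
exists C => // e' e'0; pose e := e' / 2.
have e0 : 0 < e by rewrite divr_gt0.
pose F x := f x + g x + e.
have F0 x : 0 < F x by rewrite ltr_wpDl // addr_ge0.
have cF : continuous (fun x => (F x)^-1).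
  move=> x; apply: cvgV; first by rewrite gt_eqF.
  by apply: cvgD; [apply: cvgD; [exact: cf|exact: cg]|exact: cvg_cst].
pose h1 x := f x * (F x)^-1; pose h2 x := g x * (F x)^-1.
have csh1 : compactly_supported h1 by exact: compactly_supportedM.
have csh2 : compactly_supported h2 by exact: compactly_supportedM.
have h10 x : 0 <= h1 x by rewrite mulr_ge0 // invr_ge0 ltW.
have h20 x : 0 <= h2 x by rewrite mulr_ge0 // invr_ge0 ltW.
have h12 x : h1 x + h2 x <= 1.
  by rewrite -mulrDl ler_pdivrMr // mul1r lerDl ltW.
exists [set v | (forall x, `|h1 (x * v)%g - h1 x| < e) /\
                (forall x, `|h2 (x * v)%g - h2 x| < e)].
  by apply: filterI; exact: compactly_supported_uniform.
move=> V V1 VW.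
have dV (k : H -> R) : compactly_supported k -> dominated V k.
  by move=> csk; exact: compactly_supported_dominated.
have ph (h : H -> R) : (forall x, 0 <= h x) -> (forall x, h x <= 1) ->
    (forall x, ~ (Kf `|` Kg) x -> h x = 0) ->
    covering_number V h <= C * covering_number V phi.
  move=> h_0 h_1 hK; rewrite -[C]mul1r; apply: CP => //; first exact: dV.
  move=> x; rewrite mul1r indicE; have [//|/negP xK] := boolP (_ \in _).
  by rewrite hK // => xK'; apply: xK; rewrite inE.
have ph1 : covering_number V h1 <= C * covering_number V phi.
  apply: ph => // x; first by have := h12 x; have := h20 x; lra.
  by move=> /not_orP[/fK]; rewrite /h1 => ->; rewrite mul0r.
have ph2 : covering_number V h2 <= C * covering_number V phi.
  apply: ph => // x; first by have := h12 x; have := h10 x; lra.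
  by move=> /not_orP[_ /gK]; rewrite /h2 => ->; rewrite mul0r.
have dfg : dominated V (fun x => f x + g x) by exact/dV/compactly_supportedD.
have e'E : e' = 2 * e by rewrite /e mulrC divfK.
set pphi := covering_number V phi in ph1 ph2 *.
rewrite -lerBlDr -ler_pdivrMl; last lra.
apply: le_covering_number => // s sfg; rewrite ler_pdivrMl; last lra.
have [s0 _] := sfg.
have le1 := @weighted_covering_number_le V f _ h1 e s e0 _ h10 _ (dV _ csh1) sfg.
have le2 := @weighted_covering_number_le V g _ h2 e s e0 _ h20 _ (dV _ csh2) sfg.
have {le1} le1 : covering_number V f <=
    \sum_(cs <- s) cs.1 * (h1 cs.2 + e) + e * covering_number V h1.
  apply: le1 => x; first by move=> v /VW[+ _] => /(_ x)/ltW.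
  by rewrite mulrC divfK // gt_eqF // F0.
have {le2} le2 : covering_number V g <=
    \sum_(cs <- s) cs.1 * (h2 cs.2 + e) + e * covering_number V h2.
  apply: le2 => x; first by move=> v /VW[_ +] => /(_ x)/ltW.
  by rewrite mulrC divfK // gt_eqF // F0.
have le3 : \sum_(cs <- s) cs.1 * (h1 cs.2 + e) + \sum_(cs <- s) cs.1 * (h2 cs.2 + e)
    <= (1 + e') * mass s.
  rewrite -big_split /mass mulr_sumr !big_seq.
  apply: ler_sum => cs /(allP s0) cs0; rewrite /= -mulrDr mulrC ler_wpM2r //.
  have := h12 cs.2; lra.
have le4 : e * covering_number V h1 <= e * (C * pphi) by rewrite ler_pM2l.
have le5 : e * covering_number V h2 <= e * (C * pphi) by rewrite ler_pM2l.
have : e' * C * pphi = e * (C * pphi) + e * (C * pphi) by rewrite e'E; ring.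
lra.
Qed.

End HaarFunctional.

(** * The invariant integral of a [SIN] group *)

Lemma ler_cvg_filter (R : realType) (T : Type) (F : set_system T)
    {FF : ProperFilter F} (f g : T -> R) (a b : R) :
  f x @[x --> F] --> a -> g x @[x --> F] --> b ->
  (\forall x \near F, f x <= g x) -> a <= b.
Proof.
move=> fa gb fg; have gf : (g x - f x) @[x --> F] --> b - a by exact: cvgB.
rewrite -subr_ge0 -(cvg_lim (@norm_hausdorff _ R^o) gf).
apply: limr_ge; first exact: cvgP gf.
by apply: filterS fg => x; rewrite -subr_ge0.
Qed.

Lemma ultrafilter_map (T U : Type) (q : T -> U) (F : set_system T) :
  UltraFilter F -> UltraFilter (q x @[x --> F]).
Proof.
move=> FU; split; first exact: fmap_proper_filter.
move=> G GF sub; apply/seteqP; split=> // A GA.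
case: (in_ultra_setVsetC (q @^-1` A) FU) => // FnA.
have GnA : G (~` A) by exact: sub.
by have [x []] := filter_ex (filterI GA GnA).
Qed.

Lemma ultrafilter_cvg_bounded (R : realType) (T : Type) (F : set_system T)
    (q : T -> R) (a b : R) :
  UltraFilter F -> (\forall x \near F, a <= q x <= b) -> cvg (q x @[x --> F]).
Proof.
move=> FU qab.
have := @segment_compact R a b; rewrite compact_ultra.
move=> /(_ _ (ultrafilter_map q FU)) [|l [_ ql]]; last exact: cvgP ql.
by apply: filterS qab => x; rewrite /= in_itv.
Qed.

(** The part of the theory of the Haar integral that builds traces. Additivity is
    required only for nonnegative functions, where covering numbers have it;
    signed combinations are handled by integral_signed_sum_ge0. *)
Record invariant_integral (R : realType) (H : topologicalGroupType)
    (I : (H -> R) -> R) : Prop := {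
  integralS : forall f g, compactly_supported f -> compactly_supported g ->
    (forall x, f x <= g x) -> I f <= I g;
  integralZ : forall c f, 0 <= c -> compactly_supported f ->
    I (fun x => c * f x) = c * I f;
  integralD : forall f g, compactly_supported f -> compactly_supported g ->
    (forall x, 0 <= f x) -> (forall x, 0 <= g x) ->
    I (fun x => f x + g x) = I f + I g;
  integral_translate : forall f t, compactly_supported f ->
    I (fun x => f (t * x)%g) = I f;
  integral_conj : forall f t, compactly_supported f ->
    I (fun x => f (x ^ t)%g) = I f }.

(** Conjugation-invariant neighbourhoods of 1 form a base, so an ultrafilter
    can be chosen that concentrates on arbitrarily small ones. Normalized
    covering numbers are bounded, hence converge along it, and every property
    that holds exactly or approximately for small invariant V passes to the
    limit. *)
Lemma SIN_invariant_integral (R : realType) (H : topologicalGroupType)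
    (phi : H -> R) :
    SIN H -> compactly_supported phi -> (forall x, 0 <= phi x) -> phi 1%g = 1 ->
  exists2 I, invariant_integral I & I phi = 1.
Proof.
move=> [_ sinH] csphi phi0 phi1.
pose B := filter_from (nbhs (1%g : H)) (fun W => [set V : set H |
  [/\ nbhs (1%g : H) V, V `<=` W & forall x y, V x -> V (x ^ y)%g]]).
have FB : ProperFilter B.
  apply: filter_from_proper; last first.
    by move=> W /sinH[V [V1 VW VJ]]; exists V.
  apply: filter_from_filter; first by exists setT; exact: filterT.
  move=> W1 W2 nW1 nW2; exists (W1 `&` W2); first exact: filterI.
  by move=> V [V1 VW VJ]; split; split=> // x /VW[].
have [F [FU BF]] := ultraFilterLemma FB.
have PF : ProperFilter F by exact: ultra_proper.
have near_F (W : set H) (P : set H -> Prop) : nbhs (1%g : H) W ->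
    (forall V, nbhs (1%g : H) V -> V `<=` W ->
      (forall x y, V x -> V (x ^ y)%g) -> P V) ->
    \forall V \near F, P V.
  move=> W1 WP; apply: BF; exists W => // V [V1 VW VJ]; exact: WP.
pose q (f : H -> R) V := covering_number V f / covering_number V phi.
have p_gt0 V : nbhs (1%g : H) V -> 0 < covering_number V phi.
  move=> V1; apply: lt_le_trans (ltr01 : 0 < 1 :> R) _; rewrite -phi1.
  exact/value_le_covering_number/compactly_supported_dominated.
have q_cvg f : compactly_supported f -> cvg (q f V @[V --> F]).
  move=> csf; have [M [K [M0 cK fM]]] := compactly_supported_bounded csf.
  have [C C0 CP] := covering_number_compact_bound csphi.1 phi0 phi1 cK.
  apply: (ultrafilter_cvg_bounded (a := 0) (b := M * C)) => //.
  apply: (near_F setT) => [|V V1 _ _]; first exact: filterT.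
  rewrite /q divr_ge0 ?covering_number_ge0 //; try exact: compactly_supported_dominated.
  rewrite ler_pdivrMr ?p_gt0 //=; apply: CP => //.
  exact: compactly_supported_dominated.
have eq_lim (f g : H -> R) : compactly_supported g ->
    (\forall V \near F, q f V = q g V) ->
    lim (q f V @[V --> F]) = lim (q g V @[V --> F]).
  move=> csg fg; apply: cvg_lim; first exact: norm_hausdorff.
  apply: cvg_trans (q_cvg _ csg); apply: near_eq_cvg.
  by apply: filterS fg => V ->.
exists (fun f => lim (q f V @[V --> F])); last first.
  apply: cvg_lim; first exact: norm_hausdorff.
  have q1 : \forall V \near F, q phi V = 1.
    apply: (near_F setT) => [|V V1 _ _]; first exact: filterT.
    by rewrite /q divff // gt_eqF // p_gt0.
  exact: cvg_near_cst q1.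
split.
- move=> f g csf csg fg; apply: (ler_cvg_filter (q_cvg _ csf) (q_cvg _ csg)).
  apply: (near_F setT) => [|V V1 _ _]; first exact: filterT.
  rewrite /q ler_pM2r ?invr_gt0 ?p_gt0 //; apply: covering_numberS => //.
  exact: compactly_supported_dominated.
- move=> c f c0 csf; apply: cvg_lim; first exact: norm_hausdorff.
  have : (c * q f V) @[V --> F] --> c * lim (q f V @[V --> F]).
    by apply: cvgM; [exact: cvg_cst|exact: q_cvg].
  apply: cvg_trans; apply: near_eq_cvg.
  apply: (near_F setT) => [|V V1 _ _]; first exact: filterT.
  by rewrite /q covering_numberZ ?mulrA //; exact: compactly_supported_dominated.
- move=> f g csf csg f0 g0.
  have cD : (q f V + q g V) @[V --> F] -->
      lim (q f V @[V --> F]) + lim (q g V @[V --> F]).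
    by apply: cvgD; exact: q_cvg.
  have csfg := compactly_supportedD csf csg.
  apply/eqP; rewrite eq_le; apply/andP; split.
    apply: (ler_cvg_filter (q_cvg _ csfg) cD).
    apply: (near_F setT) => [|V V1 _ _]; first exact: filterT.
    rewrite /q /= -mulrDl ler_pM2r ?invr_gt0 ?p_gt0 //.
    by apply: covering_numberD; exact: compactly_supported_dominated.
  have [C C0 CP] := covering_number_almost_additive phi0 phi1 csphi csf csg f0 g0.
  set If := lim _; set Ig := lim _; set Ifg := lim _.
  have Ifg0 : 0 <= Ifg.
    apply: limr_ge; first exact: q_cvg.
    apply: (near_F setT) => [|V V1 _ _]; first exact: filterT.
    by rewrite divr_ge0 ?covering_number_ge0 //; exact: compactly_supported_dominated.
  have step e : 0 < e -> If + Ig <= (1 + e) * Ifg + e * C.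
    move=> e0; have [W W1 WP] := CP e e0.
    have cR : ((1 + e) * q (fun x => f x + g x) V + e * C) @[V --> F] -->
        (1 + e) * Ifg + e * C.
      by apply: cvgD; [apply: cvgM; [exact: cvg_cst|exact: q_cvg]|exact: cvg_cst].
    apply: (ler_cvg_filter cD cR).
    apply: (near_F W) => // V V1 VW _.
    rewrite /q /= -mulrDl ler_pdivrMr ?p_gt0 // mulrDl mulrA divfK ?gt_eqF ?p_gt0 //.
    exact: WP.
  (* The denominator Ifg + C + 1 absorbs the factor of the error e (Ifg + C). *)
  apply/ler_addgt0Pr => e e0.
  have D0 : 0 < Ifg + C + 1 by rewrite ltr_wpDl // addr_ge0.
  have := step (e / (Ifg + C + 1)) (divr_gt0 e0 D0).
  suff : e / (Ifg + C + 1) * (Ifg + C) <= e by move: (e / _) => d; nra.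
  rewrite mulrAC ler_pdivrMr // ler_pM2l //; lra.
- move=> f t csf; apply: eq_lim => //.
  apply: (near_F setT) => [|V V1 _ _]; first exact: filterT.
  by rewrite /q covering_number_translate //; exact: compactly_supported_dominated.
- move=> f t csf; apply: eq_lim => //.
  apply: (near_F setT) => [|V V1 _ VJ]; first exact: filterT.
  by rewrite /q covering_number_conj //; exact: compactly_supported_dominated.
Qed.

(** * Central traces of [SIN] groups *)

(** Take a Urysohn function f0 supported in a small invariant neighbourhood V
    and let f x be the supremum of f0 over the conjugates of x. The supremum
    stays continuous because f0 is uniformly continuous for an invariant
    neighbourhood, which moves all conjugates of x by the same amount. The last
    conclusion holds because V and y V are disjoint. *)
Lemma SIN_central_bump (R : realType) (H : topologicalGroupType) (y : H) :
    SIN H -> y <> 1%g ->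
  exists f : H -> R, [/\ compactly_supported f, forall x, 0 <= f x, f 1%g = 1,
    forall x t, f (x ^ t)%g = f x & forall x, f x * f (y^-1 * x)%g = 0].
Proof.
move=> [[hausH lcH] sinH] y1.
(* If A and B are disjoint neighbourhoods of 1 and y, no point x satisfies
   both A x and B (y (y^-1 x)). *)
have [W W1 yW] : exists2 W : set H, nbhs (1%g : H) W &
    forall x, W x -> ~ W (y^-1 * x)%g.
  move: (hausH); rewrite open_hausdorff => /(_ 1%g y) [].
    by apply/eqP => /esym.
  move=> [A B] /= [A1 By] [oA oB AB0].
  exists (A `&` [set x | B (y * x)%g]).
    apply: filterI.
      by apply: open_nbhs_nbhs; split=> //; exact: set_mem.
    apply: (@continuous_mulgl H y 1%g); rewrite mulg1.
    by apply: open_nbhs_nbhs; split=> //; exact: set_mem.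
  move=> x [Ax _] [_ /=]; rewrite mulVKg => Bx.
  by move: AB0 => /eqP/seteqP[/(_ x)] /(_ (conj Ax Bx)).
have [K0 K01 [cK0 _]] := lcH 1%g I.
have {}K01 : nbhs (1%g : H) K0 by move: K01; rewrite /within /=; apply: filterS => x; apply.
have [V [V1 VWK VJ]] := sinH _ (filterI W1 K01).
have [f0 [cf0 f00 f01 f0_1 f0V]] : exists f0 : H -> R, [/\ continuous f0,
    forall x, 0 <= f0 x, forall x, f0 x <= 1, f0 1%g = 1 &
    forall x, ~ V x -> f0 x = 0].
  have clV : closed (~` V°) by apply: open_closedC; exact: open_interior.
  have V'1 : ~ (~` V°) 1%g by exact.
  have := @locally_compact_completely_regular H R lcH hausH 1%g _ clV V'1.
  move=> /(@uniform_separatorP H R) [f [cf rf f0 f1]].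
  have rng x : 0 <= f x <= 1.
    by have /(_ (f x)) := rf; rewrite /= in_itv /=; apply; exists x.
  exists (fun x => 1 - f x); split.
  - by move=> x; apply: cvgB; [exact: cvg_cst|exact: cf].
  - by move=> x; have := rng x; lra.
  - by move=> x; have := rng x; lra.
  - by rewrite (f0 (f 1%g)) ?subr0 //; exists 1%g.
  - move=> x Vx; rewrite (f1 (f x)) ?subrr //; exists x => //.
    by move=> /interior_subset.
have V_K0 x : V x -> K0 x by move=> /VWK[].
have csf0 : compactly_supported f0.
  by split=> //; exists K0 => // x K0x; apply: f0V => /V_K0.
pose orb x := range (fun t : H => f0 (x ^ t)%g).
have orb_ub x : has_ubound (orb x) by exists 1 => _ [t _ <-].
have orb_ne x : orb x !=set0 by exists (f0 (x ^ 1)%g), 1%g.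
pose f x := sup (orb x).
have le_f x t : f0 (x ^ t)%g <= f x by apply: ub_le_sup => //; exists t.
have f_le x b : (forall t, f0 (x ^ t)%g <= b) -> f x <= b.
  by move=> le_b; apply: ge_sup => // _ [t _ <-].
have f_ge0 x : 0 <= f x by apply: le_trans (le_f x 1%g).
have fV x : ~ V x -> f x = 0.
  move=> Vx; apply/eqP; rewrite eq_le f_ge0 andbT; apply: f_le => t.
  by rewrite f0V // => /VJ-/(_ t^-1%g); rewrite conjgK.
exists f; split=> //.
- split; last by exists K0 => // x K0x; apply: fV => /V_K0.
  move=> x; apply/cvgrPdist_le => e e0.
  have [U [U1 Uf0 UJ]] := sinH _ (compactly_supported_uniform csf0 e0).
  apply: filterS (nbhs1_translate x U1) => x' Ux'.
  rewrite -[x'](mulVKg x); move: (x^-1 * x')%g Ux' => v Uv.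
  have near_t t : `|f0 ((x * v) ^ t)%g - f0 (x ^ t)%g| <= e.
    by rewrite conjMg; apply/ltW/Uf0/UJ.
  have le1 : f x <= f (x * v)%g + e.
    apply: f_le => t; have := le_f (x * v)%g t; have := near_t t.
    rewrite ler_norml; lra.
  have le2 : f (x * v)%g <= f x + e.
    apply: f_le => t; have := le_f x t; have := near_t t.
    rewrite ler_norml; lra.
  rewrite ler_norml; lra.
- apply/eqP; rewrite eq_le; apply/andP; split; first by apply: f_le.
  by have := le_f 1%g 1%g; rewrite conj1g f0_1.
- move=> x t; apply/eqP; rewrite eq_le; apply/andP; split; apply: f_le => s.
    by rewrite -conjgM.
  by have := le_f (x ^ t)%g (t^-1 * s)%g; rewrite conjgM conjgK.
- move=> x; have [/VWK[Wx _]|/fV ->] := pselect (V x); last by rewrite mul0r.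
  by rewrite [f (_ * _)%g]fV ?mulr0 // => /VWK[/(yW _ Wx)].
Qed.

Section InvariantIntegral.
Variables (R : realType) (H : topologicalGroupType).
Variables (I : (H -> R) -> R) (intI : invariant_integral I).

Lemma compactly_supported0 : compactly_supported (fun _ : H => 0 : R).
Proof.
by split; [move=> x; exact: cvg_cst|exists set0 => //; exact: compact0].
Qed.

Lemma integral_sum (J : Type) (s : seq J) (a : J -> R) (g : J -> H -> R) :
    (forall j, compactly_supported (g j)) -> (forall j x, 0 <= g j x) ->
    (forall j, 0 <= a j) ->
  compactly_supported (fun x => \sum_(j <- s) a j * g j x) /\
  I (fun x => \sum_(j <- s) a j * g j x) = \sum_(j <- s) a j * I (g j).
Proof.
move=> csg g0 a0; elim: s => [|j s [IHcs IHI]].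
  rewrite big_nil (_ : (fun x => _) = fun=> 0); last first.
    by apply/funext => x; rewrite big_nil.
  split; first exact: compactly_supported0.
  rewrite -[RHS](mul0r (I (fun=> 0))) -(integralZ intI) //; last first.
    exact: compactly_supported0.
  by congr I; apply/funext => x; rewrite mul0r.
rewrite big_cons (_ : (fun x => _) =
    fun x => a j * g j x + \sum_(i <- s) a i * g i x); last first.
  by apply/funext => x; rewrite big_cons.
have csZ := compactly_supportedZ (a j) (csg j).
split; first exact: compactly_supportedD.
rewrite (integralD intI) // ?(integralZ intI) ?IHI // => x.
  exact: mulr_ge0.
by apply: sumr_ge0 => i _; exact: mulr_ge0.
Qed.

(** Moving the negative weights to the other side leaves an inequality
    between nonnegative combinations, where I is additive and monotone. *)
Lemma integral_signed_sum_ge0 (J : finType) (w : J -> R) (g : J -> H -> R) :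
    (forall j, compactly_supported (g j)) -> (forall j x, 0 <= g j x) ->
    (forall x, 0 <= \sum_j w j * g j x) ->
  0 <= \sum_j w j * I (g j).
Proof.
move=> csg g0 wg0.
have wE j : w j = Num.max (w j) 0 - Num.max (- w j) 0.
  by rewrite /Num.max; case: ifP => h1; case: ifP => h2; lra.
have max0 r : 0 <= Num.max r 0 :> R by rewrite le_max lexx orbT.
have [csp Ip] := integral_sum (index_enum J) csg g0 (fun j => max0 (w j)).
have [csn In] := integral_sum (index_enum J) csg g0 (fun j => max0 (- w j)).
under eq_bigr => j _ do rewrite wE mulrBl.
rewrite sumrB subr_ge0 -Ip -In; apply: (integralS intI) => // x.
rewrite -subr_ge0 -sumrB; apply: le_trans (wg0 x) _.
by apply: ler_sum => j _; rewrite -mulrBl -wE.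
Qed.

Lemma integral_complex_sum_ge0 (J : finType) (w : J -> R[i]) (g : J -> H -> R) :
    (forall j, compactly_supported (g j)) -> (forall j x, 0 <= g j x) ->
    (forall x, 0 <= \sum_j w j * (g j x)%:C) ->
  0 <= \sum_j w j * (I (g j))%:C.
Proof.
move=> csg g0 wg0.
have ReM (z : R[i]) r : complex.Re (z * r%:C) = complex.Re z * r.
  by case: z => a b; rewrite /= mulr0 subr0.
have ImM (z : R[i]) r : complex.Im (z * r%:C) = complex.Im z * r.
  by case: z => a b; rewrite /= mulr0 add0r.
have ReS (r : J -> R) :
    complex.Re (\sum_j w j * (r j)%:C) = \sum_j complex.Re (w j) * r j.
  by rewrite raddf_sum; apply: eq_bigr => j _; exact: ReM.
have ImS (r : J -> R) :
    complex.Im (\sum_j w j * (r j)%:C) = \sum_j complex.Im (w j) * r j.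
  by rewrite raddf_sum; apply: eq_bigr => j _; exact: ImM.
(* Nonnegativity in R[i] includes being real, so the imaginary weights and
   their opposites both give pointwise nonnegative combinations. *)
have ReIm x : \sum_j complex.Im (w j) * g j x = 0 /\
              0 <= \sum_j complex.Re (w j) * g j x.
  by have := wg0 x; rewrite lecE /= ReS ImS => /andP[/eqP -> ->].
rewrite lecE /= ReS ImS; apply/andP; split.
  rewrite eq_le; apply/andP; split; last first.
    by apply: integral_signed_sum_ge0 => // x; have [->] := ReIm x.
  rewrite -oppr_ge0 -sumrN; under eq_bigr => j _ do rewrite -mulNr.
  apply: integral_signed_sum_ge0 => // x; have [E _] := ReIm x.
  by under eq_bigr => j _ do rewrite mulNr; rewrite sumrN E oppr0.
by apply: integral_signed_sum_ge0 => // x; have [_] := ReIm x.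
Qed.

(** By invariance the kernel at (s_j, s_k) is the integral of the product of
    the translates of f by s_j and s_k, so the form is the integral of the
    squared modulus of a combination of translates. *)
Lemma positive_definite_autocorrelation (f : H -> R) :
    compactly_supported f -> (forall x, 0 <= f x) ->
  positive_definite (fun s => (I (fun x => f x * f (s^-1 * x)%g))%:C).
Proof.
move=> csf f0 n s c.
pose g (jk : 'I_n * 'I_n) x := f ((s jk.1)^-1 * x)%g * f ((s jk.2)^-1 * x)%g.
pose w (jk : 'I_n * 'I_n) := (c jk.1)^* * c jk.2.
have csg jk : compactly_supported (g jk).
  apply: compactly_supportedM; first exact: compactly_supported_translate.
  exact: (compactly_supported_translate _ csf).1.
have gE j k : I (fun x => f x * f (((s j)^-1 * s k)^-1 * x)%g) = I (g (j, k)).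
  rewrite -[RHS](integral_translate intI (s j)); last exact: csg.
  by congr I; apply/funext => x; rewrite /g /= mulKg invgM invgK mulgA.
set A := bigop.body _ _ _.
suff -> : A = \sum_jk w jk * (I (g jk))%:C.
  apply: integral_complex_sum_ge0 => // [jk x|x]; first exact: mulr_ge0.
  set B := bigop.body _ _ _.
  suff -> : B = (\sum_j c j * (f ((s j)^-1 * x)%g)%:C)^* *
                \sum_j c j * (f ((s j)^-1 * x)%g)%:C.
    by rewrite mulrC mul_conjC_ge0.
  rewrite rmorph_sum mulr_suml.
  under [RHS]eq_bigr => j _ do rewrite mulr_sumr.
  rewrite pair_big; apply: eq_bigr => -[j k] _ /=.
  rewrite /w /g /= rmorphM rmorphM /=.
  have -> : ((f ((s j)^-1 * x)%g)%:C)^* = (f ((s j)^-1 * x)%g)%:C :> R[i].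
    exact: conjc_real.
  ring.
rewrite /A pair_big; apply: eq_bigr => -[j k] _ /=; congr (_ * _%:C).
exact: gE.
Qed.

End InvariantIntegral.

(** The autocorrelation of a central bump, normalized by I (f * f) = 1. Its
    continuity follows from uniform continuity of f, as f (s^-1 x) = f (x s^-1)
    for a class function. *)
Lemma SIN_traces_separate (R : realType) (H : topologicalGroupType) (y : H) :
  SIN H -> y <> 1%g -> exists2 u, traces R H u & u y <> 1.
Proof.
move=> sinH /(SIN_central_bump R sinH)[f [csf f0 f1 fJ fy]].
have csff s : compactly_supported (fun x => f x * f (s^-1 * x)%g).
  by apply: compactly_supportedM csf (compactly_supported_translate _ csf).1.
have csf2 : compactly_supported (fun x => f x * f x).
  exact: compactly_supportedM csf csf.1.
have [||I intI If2] := SIN_invariant_integral sinH csf2.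
- by move=> x; exact: mulr_ge0.
- by rewrite f1 mulr1.
pose v s := I (fun x => f x * f (s^-1 * x)%g).
exists (fun s => (v s)%:C); last first.
  rewrite /v (_ : (fun x => _) = fun=> 0 * 0); last first.
    by apply/funext => x; rewrite fy mulr0.
  rewrite (integralZ intI) //; last exact: compactly_supported0.
  by rewrite mul0r => /(congr1 (@complex.Re R))/eqP /=; rewrite eq_sym oner_eq0.
split.
- have cv : continuous v.
    move=> s; apply/cvgrPdist_le => e e0.
    have If0 : 0 <= I f.
      rewrite -(mul0r (I f)) -(integralZ intI) //; apply: (integralS intI) => //.
        exact: compactly_supportedZ.
      by move=> x; rewrite mul0r.
    pose d := e / (I f + 1).
    have d0 : 0 < d by rewrite divr_gt0 // ltr_wpDl.
    have dIf : d * I f <= e.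
      by rewrite /d mulrAC ler_pdivrMr ?ltr_wpDl // ler_pM2l // lerDl.
    have near_s : \forall s' \near s, forall x,
        `|f (x * (s' * s^-1)^-1)%g - f x| < d.
      apply: (@continuous_mulgr H s^-1%g s
                (fun v => forall x, `|f (x * v^-1)%g - f x| < d)).
      apply: (@invg_continuous H _ (fun v => forall x, `|f (x * v)%g - f x| < d)).
      by rewrite mulgV invg1; exact: compactly_supported_uniform.
    have fC a x : f (a^-1 * x)%g = f (x * a^-1)%g.
      by rewrite -(fJ _ a^-1%g) conjgE invgK -mulgA mulVKg.
    apply: filterS near_s => s' near_f.
    have close x : `|f (s'^-1 * x)%g - f (s^-1 * x)%g| < d.
      have := near_f (x * s^-1)%g.
      by rewrite !fC invgM invgK mulgA mulgVK.
    have le_v a b : (forall x, `|f (a^-1 * x)%g - f (b^-1 * x)%g| < d) ->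
        v a <= v b + e.
      move=> ab; apply: (@le_trans _ _ (v b + d * I f)); last by rewrite lerD2l.
      rewrite -(integralZ intI) ?(ltW d0) // -(integralD intI) //; first last.
      + by move=> x; rewrite mulr_ge0 // ltW.
      + by move=> x; rewrite mulr_ge0.
      + exact: compactly_supportedZ.
      apply: (integralS intI) => // [|x].
        by apply: compactly_supportedD => //; exact: compactly_supportedZ.
      rewrite [d * _]mulrC -mulrDr ler_wpM2l //.
      by have := ab x; rewrite ltr_norml; lra.
    rewrite ler_norml; apply/andP; split.
      by have := le_v s' s close; lra.
    have := le_v s s'; have close' x : `|f (s^-1 * x)%g - f (s'^-1 * x)%g| < d.
      by rewrite distrC.
    by move=> /(_ close'); lra.
  move=> s; apply/cvgrPdist_lt => -[e e'].
  rewrite ltcE /= => /andP[/eqP -> e0].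
  move/cvgrPdist_lt : (cv s) => /(_ e e0); apply: filterS => s' h.
  rewrite -rmorphB /= normc_def /= expr0n addr0 sqrtr_sqr.
  by rewrite ltcR.
- exact: positive_definite_autocorrelation.
- rewrite /v invg1 (_ : (fun x => _) = fun x => f x * f x) ?If2 //.
  by apply/funext => x; rewrite mul1g.
- have vJ s t : v (s ^ t)%g = v s.
    rewrite -[RHS](integral_conj intI t^-1%g) //; congr I; apply/funext => x /=.
    rewrite fJ; congr (_ * _).
    by rewrite -[in RHS](fJ _ t) conjMg conjgKV conjVg.
  move=> s t; congr (_%:C).
  by rewrite -(vJ (t * s)%g s^-1%g) conjgE invgK mulgK.
Qed.

(** * Characters with finitely many values *)

Section UnitaryCharacter.
Variables (R : realType) (G : topologicalGroupType) (n : nat).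
Variables (n_gt0 : (0 < n)%N) (rho : G -> 'M[R[i]]_n).
Hypothesis rho_unitary : unitary_representation rho.

Definition normalized_character (x : G) : R[i] := n%:R^-1 * \tr (rho x).

Local Notation chi := normalized_character.

Let n_neq0 : n%:R != 0 :> R[i]. Proof. by rewrite pnatr_eq0 -lt0n. Qed.

Lemma normalized_character1 : chi 1%g = 1.
Proof.
by have [rho1 _ _] := rho_unitary; rewrite /chi rho1 mxtrace1 mulVf.
Qed.

Lemma unitary_representationV x : rho x^-1%g = (rho x) ^t*.
Proof.
have [rho1 rhoM rhoU] := rho_unitary.
have /unitarymxP U := rhoU x.
by rewrite -[LHS]mulmx1 -U mulmxA -rhoM mulVg rho1 mul1mx.
Qed.

Lemma mxtrace_adjoint_mul (M : 'M[R[i]]_n) :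
  \tr (M ^t* *m M) = \sum_i \sum_j (M i j)^* * M i j.
Proof.
rewrite /mxtrace; under eq_bigr => i _ do rewrite mxE.
rewrite exchange_big; apply: eq_bigr => i _; apply: eq_bigr => j _.
by rewrite !mxE.
Qed.

(** The form of the character at coefficients c is the squared
    Hilbert-Schmidt norm of sum_k c_k rho (s_k), divided by n. *)
Lemma normalized_character_trace : continuous rho -> traces R G chi.
Proof.
have [rho1 rhoM rhoU] := rho_unitary => crho; split.
- move=> x; apply: cvgM; first exact: cvg_cst.
  apply: cvg_big => [|i _]; first exact: add_continuous.
  apply: (@cvg_comp _ _ _ rho (fun M : 'M[R[i]]_n => M i i)); first exact: crho.
  exact: coord_continuous.
- move=> m s c; set A := bigop.body _ _ _.
  pose S := \sum_k c k *: rho (s k).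
  suff -> : A = n%:R^-1 * \tr (S ^t* *m S).
    rewrite mulr_ge0 ?invr_ge0 ?ler0n // mxtrace_adjoint_mul.
    by apply: sumr_ge0 => i _; apply: sumr_ge0 => j _; rewrite mulrC mul_conjC_ge0.
  have -> : S ^t* = \sum_j (c j)^* *: rho (s j)^-1%g.
    apply/matrixP => i j; rewrite !mxE summxE rmorph_sum summxE.
    by apply: eq_bigr => k _; rewrite !mxE rmorphM unitary_representationV !mxE.
  rewrite mulmx_suml raddf_sum mulr_sumr; apply: eq_bigr => j _.
  rewrite mulmx_sumr raddf_sum mulr_sumr; apply: eq_bigr => k _.
  rewrite -scalemxAl -scalemxAr -rhoM /= scalerA.
  by rewrite [\tr _]mxtraceZ /chi mulrCA.
- exact: normalized_character1.
- by move=> s t; rewrite /chi !rhoM mxtrace_mulC.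
Qed.

Definition sqmod (z : R[i]) : R := complex.Re z ^+ 2 + complex.Im z ^+ 2.

Lemma sqmodE z : z^* * z = (sqmod z)%:C.
Proof.
case: z => a b; rewrite /sqmod /=.
apply/eqP; rewrite eq_complex /=; apply/andP; split; apply/eqP; ring.
Qed.

Lemma sqmod_ge0 z : 0 <= sqmod z.
Proof. by rewrite addr_ge0 ?sqr_ge0. Qed.

(** The squared Hilbert-Schmidt distance of rho x and rho y sees x and y only
    through the character at x^-1 y. Hence the kernel of rho is where the
    character is 1, and a gap in the values of the character is a gap between
    matrices. *)
Lemma unitary_distance x y :
  \sum_i \sum_j sqmod (rho x i j - rho y i j) =
  n%:R * (2 - 2 * complex.Re (chi (x^-1 * y)%g)).
Proof.
have [rho1 rhoM rhoU] := rho_unitary.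
have trE z : \tr (rho z) = n%:R * chi z by rewrite mulrA divff ?mul1r.
have trV z : chi z^-1%g = (chi z)^*.
  rewrite /chi unitary_representationV rmorphM fmorphV rmorph_nat; congr (_ * _).
  by rewrite rmorph_sum; apply: eq_bigr => i _; rewrite !mxE.
pose z := (x^-1 * y)%g.
have : \tr ((rho x - rho y) ^t* *m (rho x - rho y)) =
    n%:R * (1 + 1 - chi z - (chi z)^*).
  have -> : (rho x - rho y) ^t* = rho x^-1%g - rho y^-1%g.
    rewrite !unitary_representationV; apply/matrixP => i j.
    by rewrite !mxE rmorphB.
  rewrite mulmxBl !mulmxBr -!rhoM !raddfB /= !trE !mulVg.
  have -> : (y^-1 * x)%g = z^-1%g by rewrite invgM invgK.
  rewrite trV normalized_character1 /z; ring.
rewrite mxtrace_adjoint_mul.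
under eq_bigr => i _ do under eq_bigr => j _ do rewrite !mxE sqmodE.
under eq_bigr => i _ do rewrite -rmorph_sum.
rewrite -rmorph_sum => /(congr1 (@complex.Re R)) /= ->.
rewrite -(rmorph_nat (real_complex R)).
rewrite -/z; case: (chi z) => a b /=; ring.
Qed.

Lemma unitary_distance_eq0 x y :
  \sum_i \sum_j sqmod (rho x i j - rho y i j) = 0 -> rho x = rho y.
Proof.
move/eqP; rewrite psumr_eq0 => [/allP sum0|i _]; last first.
  by apply: sumr_ge0 => j _; exact: sqmod_ge0.
apply/matrixP => i j; apply/eqP; rewrite -subr_eq0.
have := sum0 i; rewrite mem_index_enum => /(_ isT).
rewrite psumr_eq0 => [/allP/(_ j)|k _]; last exact: sqmod_ge0.
rewrite mem_index_enum => /(_ isT) /=.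
by rewrite paddr_eq0 ?sqr_ge0 // !sqrf_eq0 eq_complex.
Qed.

Lemma normalized_character_eq1 x : chi x = 1 -> rho x = 1%:M.
Proof.
move=> chix; have [<- _ _] := rho_unitary; apply/esym/unitary_distance_eq0.
by rewrite unitary_distance invg1 mul1g chix /= mulr1 subrr mulr0.
Qed.

Hypothesis fin_chi : finite_set (range chi).

(** The positive values of n (2 - 2 Re chi) form a finite set, so they have a
    positive lower bound. *)
Lemma finite_character_gap : exists2 e : R, 0 < e &
  forall x y, chi (x^-1 * y)%g <> 1 ->
    e <= \sum_i \sum_j sqmod (rho x i j - rho y i j).
Proof.
have [s sP] : exists s : seq R[i], range chi = [set` s] by exact/finite_seqP.
pose gap (z : R[i]) : R := n%:R * (2 - 2 * complex.Re z).
have gap_gt0 x : chi x <> 1 -> 0 < gap (chi x).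
  move=> chix; have := unitary_distance 1%g x; rewrite invg1 mul1g => E.
  rewrite /gap -E lt_def sumr_ge0 ?andbT => [|i _]; last first.
    by apply: sumr_ge0 => j _; exact: sqmod_ge0.
  apply/eqP => /unitary_distance_eq0 rhox; apply: chix.
  by rewrite -normalized_character1 /chi rhox.
(* The seed 1 keeps the minimum positive when no value has a gap. *)
pose t := [seq z <- s | 0 < gap z].
exists (\big[Num.min/1]_(z <- t) gap z).
  rewrite big_seq; elim/big_ind: _ => // [a b a0 b0|z]; first by rewrite lt_min a0.
  by rewrite mem_filter => /andP[].
move=> x y chixy; rewrite unitary_distance -/(gap _).
set z := chi _ in chixy *.
have : z \in t.
  rewrite mem_filter gap_gt0 //=.
  suff : [set` s] z by [].
  by rewrite -sP; exists (x^-1 * y)%g.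
elim: t => // a t IHt; rewrite inE big_cons ge_min => /orP[/eqP ->|/IHt ->].
  by rewrite lexx.
by rewrite orbT.
Qed.

Lemma unitary_coeff_le1 x i j :
  `|complex.Re (rho x i j)| <= 1 /\ `|complex.Im (rho x i j)| <= 1.
Proof.
have [_ _ /(_ x)/unitarymxP/matrixP/(_ i i)] := rho_unitary.
rewrite !mxE eqxx; under eq_bigr => k _ do rewrite !mxE mulrC sqmodE.
rewrite -rmorph_sum => /(congr1 (@complex.Re R)) /= sum1.
have : sqmod (rho x i j) <= 1.
  rewrite -sum1 (bigD1 j) //= lerDl; apply: sumr_ge0 => k _; exact: sqmod_ge0.
rewrite /sqmod; set a := complex.Re _; set b := complex.Im _ => ab.
rewrite !ler_norml; split; nra.
Qed.

(** The image of rho is uniformly discrete and its coefficients are bounded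
    by 1, so rounding the coefficients on a fine grid identifies x and y only
    if rho x = rho y. *)
Lemma finite_character_cells : exists (T : finType) (F : G -> T),
  forall x y, F x = F y -> chi (x^-1 * y)%g = 1.
Proof.
have [e e0 eP] := finite_character_gap.
(* With mesh 1 / M, each coefficient of rho x - rho y in the same cell has
   squared modulus at most 2 / M, and n ^ 2 of them stay below e. *)
pose B : R := n%:R ^+ 2 * 2 / e.
have B0 : 0 <= B by rewrite divr_ge0 ?(ltW e0) // mulr_ge0 // exprn_ge0.
pose M := (Num.truncn B).+1.
have M1 : 1 <= M%:R :> R by rewrite ler1n.
have M0 : 0 < M%:R :> R by rewrite ltr0n.
have BM : B < M%:R by have /andP[] := truncn_itv B0.
pose K := (M * 2)%N.
pose cell (r : R) : 'I_K.+1 := inord (Num.truncn (M%:R * (r + 1))).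
have cellP r r' : `|r| <= 1 -> `|r'| <= 1 -> cell r = cell r' ->
    `|r - r'| * M%:R < 1.
  rewrite !ler_norml => /andP[r1 r2] /andP[r1' r2'].
  have itv (a : R) : -1 <= a -> a <= 1 -> let t := Num.truncn (M%:R * (a + 1)) in
      (t < K.+1)%N /\ t%:R <= M%:R * (a + 1) < t%:R + 1.
    move=> a1 a2 t; have s0 : 0 <= M%:R * (a + 1) by rewrite mulr_ge0 //; lra.
    have := truncn_itv s0; rewrite -/t -natr1 => tP; split=> //.
    rewrite ltnS -(ler_nat R); case/andP: tP => /le_trans -> //.
    by rewrite /K natrM ler_wpM2l //; lra.
  have [lt1 /andP[ge1 le1]] := itv r r1 r2.
  have [lt2 /andP[ge2 le2]] := itv r' r1' r2'.
  move=> /(congr1 val); rewrite /cell /= !inordK // => E.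
  rewrite E in ge1 le1; rewrite -[M%:R]ger0_norm // -normrM ltr_norml.
  by rewrite mulrBl !(mulrC _ M%:R); apply/andP; split; lra.
exists {ffun 'I_n * 'I_n -> 'I_K.+1 * 'I_K.+1}.
exists (fun x => [ffun ij => (cell (complex.Re (rho x ij.1 ij.2)),
                              cell (complex.Im (rho x ij.1 ij.2)))]).
move=> x y /ffunP Fxy; apply: contrapT => /eP; apply/negP; rewrite -ltNge.
have sq_le i j : sqmod (rho x i j - rho y i j) * M%:R <= 2.
  have := Fxy (i, j); rewrite !ffunE /= => -[].
  have [rx ix] := unitary_coeff_le1 x i j; have [ry iy] := unitary_coeff_le1 y i j.
  move=> /(cellP _ _ rx ry) hr /(cellP _ _ ix iy) hi.
  have sq (a : R) : `|a| * M%:R < 1 -> a ^+ 2 * M%:R <= 1.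
    rewrite -real_normK ?num_real //; have := normr_ge0 a.
    by move: `|a| => d d0 dM; nra.
  rewrite /sqmod mulrDl !raddfB /=; have := sq _ hr; have := sq _ hi; lra.
rewrite -(ltr_pM2r M0) mulr_suml; apply: (@le_lt_trans _ _ (n%:R ^+ 2 * 2)).
  apply: (@le_trans _ _ (\sum_(i < n) \sum_(j < n) 2)).
    by apply: ler_sum => i _; rewrite mulr_suml; apply: ler_sum.
  have sum_const (c : R) : \sum_(i < n) \sum_(j < n) c = n%:R ^+ 2 * c.
    by rewrite sumr_const card_ord sumr_const card_ord expr2 -mulrA !mulr_natl.
  by rewrite sum_const.
by rewrite -ltr_pdivrMl // mulrC.
Qed.

End UnitaryCharacter.

(** * Tracial, [SIN] and [MAP] kernels *)

Lemma trace_pullback (R : realType) (G : topologicalGroupType)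
    (N : normalSubgroup G) (u : quotient_group N -> R[i]) :
  traces R (quotient_group N) u -> traces R G (u \o quot_pi N).
Proof.
move=> [cu pu u1 tu]; split.
- move=> x; apply: continuous_comp; first exact: quot_pi_continuous.
  exact: cu.
- move=> n s c; have := pu n (fun j => quot_pi N (s j)) c.
  congr (0 <= _); apply: eq_bigr => j _; apply: eq_bigr => k _.
  by rewrite /= -[quot_pi N (_ * _)%g]quot_piM -quot_piV.
- exact: u1.
- move=> s t; rewrite /= -[quot_pi N (s * t)%g]quot_piM.
  by rewrite -[quot_pi N (t * s)%g]quot_piM; exact: tu.
Qed.

Lemma quot_pi_neq1 (G : topologicalGroupType) (N : normalSubgroup G) (x : G) :
  ~ nsubg_set N x -> quot_pi N x <> 1%g.
Proof.
by move=> Nx /esym/quot_piE; rewrite invg1 mul1g.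
Qed.

(** A point outside N is moved away from 1 by a trace of G / N. *)
Lemma tracial_kernel_sub_SIN_kernel (R : realType) (G : topologicalGroupType) :
  tracial_kernel R G `<=` SIN_kernel G.
Proof.
move=> x tx N [_ sinN]; apply: contrapT => /quot_pi_neq1 piN.
have [u tu ux] := SIN_traces_separate R sinN piN.
exact/ux/(tx _ (trace_pullback tu)).
Qed.

Lemma class_kernelM (P : topologicalGroupType -> Prop) (G : topologicalGroupType)
    (x y : G) :
  class_kernel P G x -> class_kernel P G y -> class_kernel P G (x * y)%g.
Proof. by move=> Px Py N PN; apply: nsubgM; [exact: Px|exact: Py]. Qed.

Lemma class_kernel_open (P : topologicalGroupType -> Prop)
    (G : topologicalGroupType) :
  nbhs (1%g : G) (class_kernel P G) -> open (class_kernel P G).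
Proof.
move=> N1; rewrite openE => x Px; apply: filterS (nbhs1_translate x N1) => y Py.
by rewrite -[y](mulVKg x); exact: class_kernelM.
Qed.

(** The function F refines the partition into left cosets. *)
Lemma class_kernel_finite_index (P : topologicalGroupType -> Prop)
    (G : topologicalGroupType) (T : finType) (F : G -> T) :
    (forall x y, F x = F y -> class_kernel P G (x^-1 * y)%g) ->
  ~ infinite_index (class_kernel P G).
Proof.
move=> FP; apply.
(* xget picks a representative of each value of F; the default 1 is used
   only outside the range of F. *)
pose h t := [set (xget 1%g [set x | F x = t] * k)%g | k in class_kernel P G].
apply: sub_finite_set (finite_image h (finite_finset (X := setT))).
move=> _ [x _ <-]; exists (F x) => //.
have : F (xget 1%g [set y | F y = F x]) = F x.
  by case: xgetP => [y _ //|/(_ x)]; case.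
rewrite /h; move: (xget _ _) => y Fyx.
apply/seteqP; split=> _ [k Pk <-].
  exists ((x^-1 * y) * k)%g; last by rewrite !mulgA mulgV mul1g.
  by apply: class_kernelM => //; apply: FP.
exists ((y^-1 * x) * k)%g; last by rewrite !mulgA mulgV mul1g.
by apply: class_kernelM => //; apply: FP.
Qed.

(** A point outside N is separated from 1 by a representation of G / N, whose
    pullback to G has a character different from 1 there. *)
Lemma MAP_kernel_of_characters (R : realType) (G : topologicalGroupType) (x : G) :
    (forall n (rho : G -> 'M[R[i]]_n), (0 < n)%N -> unitary_representation rho ->
      continuous rho -> normalized_character rho x = 1) ->
  MAP_kernel R G x.
Proof.
move=> chix N [_ [_ mapN]]; apply: contrapT => /quot_pi_neq1 piN.
have [n [rho [rhoU crho rhox]]] := mapN _ _ piN.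
(* Matrices of size 0 are all equal and separate nothing. *)
have n_gt0 : (0 < n)%N.
  by case: n rho rhoU crho rhox => // rho _ _; case; apply/matrixP => -[].
pose sigma x := rho (quot_pi N x).
have sigmaU : unitary_representation sigma.
  have [rho1 rhoM rhoU'] := rhoU; split=> // [y z|y]; last exact: rhoU'.
  by rewrite /sigma -[quot_pi N (y * z)%g]quot_piM; exact: rhoM.
have csigma : continuous sigma.
  move=> y; apply: (@continuous_comp _ _ _ (quot_pi N) rho); last exact: crho.
  exact: quot_pi_continuous.
apply: rhox; have [-> _ _] := rhoU.
exact: (normalized_character_eq1 n_gt0 sigmaU (chix n sigma n_gt0 sigmaU csigma)).
Qed.

Theorem proposition2p4 (R : realType) (G : topologicalGroupType)
    (lcG : locally_compact_group G) :
  [/\ tracial_kernel R G `<=` SIN_kernel G,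
      ~ open (SIN_kernel G) ->
        @infinite_dimensional R[i] (G -> R[i]) (traces R G) &
      infinite_index (MAP_kernel R G) ->
        @infinite_dimensional R[i] (G -> R[i]) (traces R G)].
Proof.
split; first exact: tracial_kernel_sub_SIN_kernel.
- apply: contra_notP => fin_dim; apply: class_kernel_open.
  have [l lT lP] := finitely_many_traces_determine fin_dim (@subset_refl _ _).
  apply: (@filterS _ _ _ [set x | forall v, List.In v l -> v x = 1]).
    by move=> x lx; apply: (tracial_kernel_sub_SIN_kernel (R := R)) => u tu; exact: lP.
  elim: l lT {lP} => [_|v l IHl lT]; first by apply: filterS filterT => x _ v [].
  have tv : traces R G v by apply: lT; left.
  have nv : nbhs (1%g : G) (v @^-1` [set 1]).
    by apply: open_nbhs_nbhs; split; [exact: open_trace_kernel|case: tv].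
  have nl : nbhs (1%g : G) [set x | forall w, List.In w l -> w x = 1].
    by apply: IHl => w lw; apply: lT; right.
  by apply: filterS (filterI nv nl) => x [vx lx] w [<-//|/lx].
- apply: contraPP => fin_dim.
  pose S : set (G -> R[i]) := [set u | exists n (rho : G -> 'M[R[i]]_n),
    [/\ (0 < n)%N, unitary_representation rho, continuous rho &
        u = normalized_character rho]].
  have ST : S `<=` traces R G.
    by move=> _ [n [rho [n0 rhoU crho ->]]]; exact: normalized_character_trace.
  have [l lS lP] := finitely_many_traces_determine fin_dim ST.
  suff [T [F FP]] : exists (T : finType) (F : G -> T), forall x y, F x = F y ->
      forall v, List.In v l -> v (x^-1 * y)%g = 1.
    apply: (class_kernel_finite_index (F := F)) => x y /FP lxy.
    apply: MAP_kernel_of_characters => n rho n0 rhoU crho.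
    by apply: (lP _ lxy); exists n, rho.
  elim: l lS {lP} => [_|v l IHl lS]; first by exists unit, (fun=> tt).
  have [|T [F FP]] := IHl; first by move=> w lw; apply: lS; right.
  have [n [rho [n0 rhoU crho vE]]] := lS v (or_introl erefl).
  have fin_v : finite_set (range (normalized_character rho)).
    by apply: finite_range_trace => //; exact: normalized_character_trace.
  have [T' [F' FP']] := finite_character_cells n0 rhoU fin_v.
  exists (T' * T)%type, (fun x => (F' x, F x)) => x y [/FP' Exy /FP lxy] w.
  by case=> [<-|/lxy//]; rewrite vE.
Qed.
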